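(* Let $n,k\ge1$ be integers and let $X\subset\mathbb{R}^{(k+1)n}$ be a non-empty Borel set with $\dim X\le1$. Then for $\mathcal{L}^k$-almost all $t\in\mathbb{R}^k$, $$\dim\pi_t(X)=\dim X.$$
   Context: $\dim$ denotes Hausdorff dimension and $\mathcal{L}^k$ Lebesgue measure on $\mathbb{R}^k$. Write $x\in\mathbb{R}^{(k+1)n}$ as $x=(x_0,x_1,\dots,x_k)$ with $x_i\in\mathbb{R}^n$. For $t=(t_1,\dots,t_k)\in\mathbb{R}^k$, $\pi_t:\mathbb{R}^{(k+1)n}\to\mathbb{R}^n$ is defined by $\pi_t(x_0,x_1,\dots,x_k)=x_0+t_1x_1+\dots+t_kx_k$. *)

(* Defs.v *)
From HB Require Import structures.
From mathcomp Require Import all_boot all_order all_algebra.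
From mathcomp Require Import all_classical all_reals all_analysis.

Set Implicit Arguments.
Unset Strict Implicit.
Unset Printing Implicit Defensive.

Import Order.TTheory GRing.Theory Num.Theory.
Import numFieldNormedType.Exports.

Local Open Scope classical_set_scope.
Local Open Scope ring_scope.

(* The norm `|x| on 'rV[R]_m is the sup norm, hence the explicit definition. *)
Definition euclidean_norm (R : realType) (m : nat) (x : 'rV[R]_m) : R :=
  Num.sqrt (\sum_(i < m) x 0 i ^+ 2).

(* The maximum with 0 makes the diameter of the empty set equal to 0. *)
Definition diam (R : realType) (m : nat) (E : set 'rV[R]_m) : \bar R :=
  maxe 0%E (ereal_sup
    [set z | exists x y, [/\ E x, E y & z = (euclidean_norm (x - y))%:E]]).

(* diam(E)^s with the conventions diam(set0)^s = 0 for all s >= 0 and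
   diam(E)^0 = 1 for E nonempty, so that the case s = 0 of hausdorff_measure
   is the counting measure. *)
Definition diam_pow (R : realType) (m : nat) (s : R) (E : set 'rV[R]_m) :
    \bar R :=
  if E == set0 then 0%E else (diam E `^ s)%E.

Definition hausdorff_content (R : realType) (m : nat) (s delta : R)
    (A : set 'rV[R]_m) : \bar R :=
  ereal_inf [set z | exists E : nat -> set 'rV[R]_m,
    [/\ A `<=` \bigcup_i E i,
        (forall i, (diam (E i) <= delta%:E)%E) &
        z = (\sum_(0 <= i <oo) diam_pow s (E i))%E]].

Definition hausdorff_measure (R : realType) (m : nat) (s : R)
    (A : set 'rV[R]_m) : \bar R :=
  ereal_sup [set hausdorff_content s delta A | delta in [set d : R | 0 < d]].

Definition hausdorff_dim (R : realType) (m : nat) (A : set 'rV[R]_m) :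
    \bar R :=
  ereal_inf [set s%:E | s in
    [set s : R | 0 <= s /\ hausdorff_measure s A = 0%E]].

Definition borel_set (R : realType) (m : nat) (A : set 'rV[R]_m) : Prop :=
  <<s [set U : set 'rV[R]_m | open U] >> A.

Definition closed_box (R : realType) (k : nat) (a b : 'rV[R]_k) :
    set 'rV[R]_k :=
  [set t | forall j, a 0 j <= t 0 j <= b 0 j].

(* k-dimensional Lebesgue outer measure. *)
Definition lebesgue_outer (R : realType) (k : nat) (A : set 'rV[R]_k) :
    \bar R :=
  ereal_inf [set z | exists a b : nat -> 'rV[R]_k,
    [/\ (forall i j, a i 0 j <= b i 0 j),
        A `<=` \bigcup_i closed_box (a i) (b i) &
        z = (\sum_(0 <= i <oo) (\prod_(j < k) (b i 0 j - a i 0 j))%:E)%E]].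

(* A set is Lebesgue measurable of measure zero if and only if its Lebesgue
   outer measure is zero. *)
Definition lebesgue_ae (R : realType) (k : nat) (P : 'rV[R]_k -> Prop) :
    Prop :=
  lebesgue_outer [set t | ~ P t] = 0%E.

(* The i-th block x_i in R^n of x in R^((k+1)n): vec_mx lays out the
   coordinates of x in k.+1 consecutive rows of length n. *)
Definition coord_block (R : realType) (n k : nat) (x : 'rV[R]_(k.+1 * n))
    (i : 'I_k.+1) : 'rV[R]_n :=
  row i (vec_mx x).

(* lift ord0 i is the index i + 1, so t 0 i is the scalar t_(i+1). *)
Definition pi_map (R : realType) (n k : nat) (t : 'rV[R]_k)
    (x : 'rV[R]_(k.+1 * n)) : 'rV[R]_n :=
  coord_block x ord0 + \sum_(i < k) t 0 i *: coord_block x (lift ord0 i).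

(* Main.v *)
(* Write D for the dimension of X; since pi_t is Lipschitz only the lower bound
   needs proof.  Fix s' < s < D <= 1.  The content of exponent s computed with
   dyadic cubes is positive on X and continuous along increasing sequences of
   arbitrary sets.  As the Borel set X is Suslin, Choquet's capacitability
   argument yields decreasing sets D_M, whose limit is a compact subset of X,
   with content bounded below.  Saturating cubes greedily gives, for each M, a
   finitely supported measure on D_M of mass bounded below with mu(Q) <= side(Q)^s
   for all cubes Q of side at least 2^-M.

   For z <> 0 the parameters t in a bounded box with |pi_t z| <= r fill at most a
   proportion O(r / |z|) of the box.  Hence the s'-energies of the images of these
   measures under pi_t, truncated at scale 2^-M, have bounded averages over a grid
   of parameters t of mesh 2^-M.  If pi_t X has dimension less than s', then by
   compactness and Cauchy-Schwarz these energies are eventually larger than any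
   constant.  By Markov's inequality, and by continuity along increasing sequences
   applied once more, now to the dyadic content of exponent k in the space of
   parameters, such t form a null set. *)
Require Import Defs.
From mathcomp Require Import all_boot all_order all_algebra.
From mathcomp Require Import all_classical all_reals all_analysis.
From mathcomp Require Import ring lra zify.

Set Implicit Arguments.
Unset Strict Implicit.
Unset Printing Implicit Defensive.

Import Order.TTheory GRing.Theory Num.Theory.
Import numFieldNormedType.Exports.

Local Open Scope classical_set_scope.
Local Open Scope ring_scope.

(** * Dyadic contents and increasing sets *)

Section NetContent.
Context {R : realType} {T : Type} {K : eqType}.
Variables (lev : nat -> T -> K) (w : nat -> R).
Hypothesis levS : forall m x y, lev m.+1 x = lev m.+1 y -> lev m x = lev m y.
Implicit Types (U V : set (nat * K)) (A D : set T).

Lemma lev_le m m' x y : (m <= m')%N -> lev m' x = lev m' y -> lev m x = lev m y.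
Proof.
by move=> /subnK <-; elim: (_ - _)%N => [//|i IH]; rewrite addSn => /levS /IH.
Qed.

(** Bounding all finite subfamilies expresses that the total weight of a possibly infinite [U] is at
    most [c]. *)
Definition weight_le U (c : R) := forall s : seq (nat * K),
  uniq s -> (forall q, q \in s -> U q) -> \sum_(q <- s) w q.1 <= c.

Definition covers U A := forall x, A x -> exists m, U (m, lev m x).

Definition content_le A (c : R) := exists U, covers U A /\ weight_le U c.

Lemma content_le_ge0 A c : content_le A c -> 0 <= c.
Proof. by move=> [U [_ /(_ [::] isT)]]; rewrite big_nil; exact. Qed.

Lemma content_leW A B c c' : B `<=` A -> c <= c' -> content_le A c ->
  content_le B c'.
Proof.
move=> BA cc' [U [UA Uc]]; exists U; split => [x /BA /UA//|s us sU].
exact: le_trans (Uc s us sU) cc'.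
Qed.

(** The non-empty dyadic descendants of cells of [U], a cell counting as its own descendant. *)
Definition inside U : set (nat * K) := [set q | exists x,
  lev q.1 x = q.2 /\ exists m, [/\ (m <= q.1)%N & U (m, lev m x)]].

(** Exchange argument: replacing the cells of [U] inside [P] by those of [V] gives another cover of
    [A], whereas [U] exceeds the lower bound [a] for covers of [A] by at most [e]. *)
Lemma weight_le_replace A U V (a e b : R) (f : seq (nat * K)) (P : set (nat * K)) :
  (forall c, content_le A c -> a <= c) -> covers U A -> weight_le U (a + e) ->
  uniq f -> (forall q, q \in f -> (U `&` inside P) q) ->
  weight_le (V `&` inside P) b ->
  (forall x m, A x -> U (m, lev m x) -> inside P (m, lev m x) ->
     exists m', (V `&` inside P) (m', lev m' x)) ->
  \sum_(q <- f) w q.1 <= b + e.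
Proof.
move=> amin covU wtU uf fUP wtV VP.
suff /amin : content_le A (a + e - \sum_(q <- f) w q.1 + b) by lra.
exists ((U `\` inside P) `|` (V `&` inside P)); split => [x Ax|s us sUV].
  have [m Um] := covU _ Ax; have [iP|nP] := pselect (inside P (m, lev m x)).
    by have [m' ?] := VP _ _ Ax Um iP; exists m'; right.
  by exists m; left.
rewrite (bigID (fun q => `[< inside P q >])) /= addrC lerD //.
  rewrite lerBrDr -big_filter -big_cat /=; apply: wtU.
    rewrite cat_uniq filter_uniq // uf andbT /=; apply/hasPn => q /fUP [_ iP].
    by rewrite mem_filter; apply/negP => /andP[/asboolP].
  move=> q; rewrite mem_cat => /orP[|/fUP[]//].
  by rewrite mem_filter => /andP[/asboolP nP /sUV [[]|[]]].
rewrite -big_filter; apply: wtV; first exact: filter_uniq.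
by move=> q; rewrite mem_filter => /andP[/asboolP iP /sUV [[]|]].
Qed.

(** Take covers of the [A n] optimal up to [eps n] and keep the maximal cells of all of them.
    Passing from one cover to the next by exchange costs [eps n], and these errors sum to at most
    [e]. *)
Lemma content_le_bigcup (A : nat -> set T) (c e : R) :
  (forall n, A n `<=` A n.+1) -> (forall n, content_le (A n) c) -> 0 < e ->
  content_le (\bigcup_n A n) (c + e).
Proof.
move=> Ainc Ac e0.
pose a n := inf [set b | content_le (A n) b].
pose eps n : R := e / 2 ^+ n.+1.
have eps0 n : 0 < eps n by rewrite divr_gt0 ?exprn_gt0.
have hinf n : has_inf [set b | content_le (A n) b].
  by split; [exists c; exact: Ac|exists 0 => b /content_le_ge0].
have amin n b : content_le (A n) b -> a n <= b.
  by move=> ?; apply: ge_inf => //; case: (hinf n).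
have /choice [U UP] n : exists U, covers U (A n) /\ weight_le U (a n + eps n).
  have [b [V [VA Vb]] ba] := inf_adherent (eps0 n) (hinf n).
  exists V; split => // s us sV; exact: le_trans (Vb s us sV) (ltW ba).
have Alen n m : (n <= m)%N -> A n `<=` A m.
  by move=> /subnK <-; elim: (m - n)%N => [//|i IH] x /IH; exact: Ainc.
(* Maximal cells: no strictly coarser cell around the point belongs to any of the covers. *)
pose W : set (nat * K) := [set q | exists x, [/\ lev q.1 x = q.2,
  exists n, U n q & forall m n, (m < q.1)%N -> ~ U n (m, lev m x)]].
have Wmin q x m n : W q -> lev q.1 x = q.2 -> (m < q.1)%N -> ~ U n (m, lev m x).
  move=> [y [yq _ h]] xq mq; rewrite (@lev_le m q.1 x y) ?(ltnW mq) ?xq //.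
  exact: h.
exists W; split.
  move=> x [n _ Anx].
  have ex : exists m, `[< exists n, U n (m, lev m x) >].
    by have [m Um] := (UP n).1 _ Anx; exists m; apply/asboolP; exists n.
  case: (ex_minnP ex) => m /asboolP Um mmin; exists m, x; split => //= m' n' m'm Um'.
  by have := mmin m'; rewrite leqNgt m'm; move/(_ (asboolT (ex_intro _ n' Um'))).
move=> s us sW.
(* [r q] is the first index whose cover contains [q]. *)
have /choice [r rP] q : exists n, W q -> U n q /\ forall i, U i q -> (n <= i)%N.
  have [Wq|nW] := pselect (W q); last by exists 0%N.
  have [x [_ [n Un] _]] := Wq.
  have ex : exists n, `[< U n q >] by exists n; apply/asboolP.
  case: (ex_minnP ex) => i /asboolP Ui imin; exists i => _; split => // j Uj.
  by apply: imin; apply/asboolP.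
pose P n : set (nat * K) := [set q | q \in s /\ (r q <= n)%N].
pose S n := \sum_(q <- s | (r q <= n)%N) w q.1.
(* The bound [b] is general because the weight [g] of the cells new at step [n.+1] is subtracted
   from it in the induction. *)
have claim n b : weight_le (U n `&` inside (P n)) b ->
    S n <= b + \sum_(i < n) eps i.
  elim: n b => [|n IH] b wb.
    rewrite big_ord0 addr0 /S -big_filter; apply: wb; first exact: filter_uniq.
    move=> q; rewrite mem_filter leqn0 => /andP[/eqP rq qs].
    have Wq := sW _ qs; split; first by rewrite -rq; exact: (rP _ Wq).1.
    have [x [xq _ _]] := Wq; exists x; split => //; exists q.1; split => //.
    by rewrite xq -surjective_pairing /P /= rq.
  pose g := \sum_(q <- s | r q == n.+1) w q.1.
  have -> : S n.+1 = S n + g.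
    rewrite /S /g (bigID (fun q => r q == n.+1)) /= addrC; congr (_ + _).
      by apply: eq_bigl => q; rewrite andbC -ltn_neqAle ltnS.
    by apply: eq_bigl => q; case: eqP => [->|]; rewrite ?leqnn ?andbF.
  (* A new cell is not inside [P n]: a strictly larger cell there would contradict maximality, an
     equal one would have appeared earlier. *)
  have wb' : weight_le (U n.+1 `&` inside (P n)) (b - g).
    move=> h uh hU; rewrite lerBrDr /g -[X in _ + X]big_filter -big_cat; apply: wb.
      rewrite cat_uniq uh filter_uniq // andbT /=; apply/hasPn => q.
      rewrite mem_filter => /andP[/eqP rq qs]; apply/negP => /hU [_ [x [xq]]].
      move=> [m [mq [ms rm]]].
      have [mltq|] := ltnP m q.1.
        by have := Wmin _ _ _ _ (sW _ qs) xq mltq; apply; exact: (rP _ (sW _ ms)).1.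
      move=> qm; have mE : m = q.1 by apply/eqP; rewrite eqn_leq mq qm.
      by move: rm; rewrite mE xq -surjective_pairing rq ltnn.
    move=> q; rewrite mem_cat => /orP[/hU [Uq [x [xq [m [mq [ms rm]]]]]]|].
      split => //; exists x; split => //; exists m; split => //; split => //.
      exact: leqW.
    rewrite mem_filter => /andP[/eqP rq qs]; have Wq := sW _ qs.
    split; first by rewrite -rq; exact: (rP _ Wq).1.
    have [x [xq _ _]] := Wq; exists x; split => //; exists q.1; split => //.
    by rewrite xq -surjective_pairing /P /= rq.
  have wn : weight_le (U n `&` inside (P n)) (b - g + eps n).
    move=> f uf fU.
    apply: (@weight_le_replace (A n) (U n) (U n.+1) (a n) (eps n) _ f (P n)) => //.
    - exact: amin.
    - exact: (UP n).1.
    - exact: (UP n).2.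
    (* The cell of the next cover at [x] cannot be strictly larger than the maximal cell of [P n]
       around [x], so it lies inside it. *)
    move=> x m Ax Um [y [/= yx [m' [m'm Pm']]]].
    rewrite (@lev_le m' m y x) // in Pm'.
    have [p Up] := (UP n.+1).1 _ (Ainc _ _ Ax).
    exists p; split => //; exists x; split => //=; exists m'; split => //.
    rewrite leqNgt; apply/negP => pm'.
    exact: (Wmin (m', lev m' x) x p n.+1 (sW _ Pm'.1) erefl pm').
  have := IH _ wn; rewrite big_ord_recr /=; lra.
pose N := \max_(q <- s) r q.
have -> : \sum_(q <- s) w q.1 = S N.
  rewrite /S [LHS]big_seq [RHS]big_seq_cond; apply: eq_bigl => q.
  by case: (boolP (q \in s)) => //= qs; rewrite (@leq_bigmax_seq _ _ _ _ q).
have /claim : weight_le (U N `&` inside (P N)) (a N + eps N).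
  by move=> f uf fU; apply: (UP N).2 => // q /fU [].
have /amin := Ac N.
have : \sum_(i < N.+1) eps i <= e.
  have -> : \sum_(i < N.+1) eps i = e * (1 - 2^-1 ^+ N.+1).
    elim: N.+1 => [|i IH]; first by rewrite big_ord0 expr0 subrr mulr0.
    by rewrite big_ord_recr IH /eps /= !exprVn exprS; field; rewrite expf_neq0.
  by rewrite ger_pMr // gerBl exprn_ge0.
rewrite big_ord_recr /=; lra.
Qed.

End NetContent.

(** * Finite Frostman measures *)

Section Frostman.
Context {R : realType} {T K : eqType}.
Variables (lev : nat -> T -> K) (w : nat -> R).
Hypothesis levS : forall m x y, lev m.+1 x = lev m.+1 y -> lev m x = lev m y.
Hypothesis w0 : forall m, 0 <= w m.

(* Masses are added greedily, point by point, until some cell containing the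
   new point is saturated. *)
Lemma greedy_mass (M : nat) (S : seq T) : exists L : seq (T * R),
  [/\ map fst L = S, (forall p, p \in L -> 0 <= p.2),
    (forall m c, (m <= M)%N -> \sum_(p <- L | lev m p.1 == c) p.2 <= w m) &
    forall x, x \in S -> exists2 m, (m <= M)%N &
      \sum_(p <- L | lev m p.1 == lev m x) p.2 = w m].
Proof.
elim: S => [|x S [L [LS Lp Lw Lt]]].
  by exists [::]; split => // m c _; rewrite big_nil.
pose g (m : 'I_M.+1) := w m - \sum_(p <- L | lev m p.1 == lev m x) p.2.
pose m0 := [arg min_(i < ord0 : 'I_M.+1) g i]%O.
have gmin m : g m0 <= g m by rewrite /m0; case: arg_minP => // i _; apply.
have g0 : 0 <= g m0 by rewrite subr_ge0 Lw // -ltnS.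
have Lw' m c : (m <= M)%N ->
    \sum_(p <- (x, g m0) :: L | lev m p.1 == c) p.2 <= w m.
  move=> mM; rewrite big_cons /=; case: eqP => [<-|_]; last exact: Lw.
  by have := gmin (Ordinal (mM : (m < M.+1)%N)); rewrite /g /=; lra.
exists ((x, g m0) :: L); split => //=.
- by rewrite LS.
- by move=> p; rewrite inE => /orP[/eqP -> //|]; exact: Lp.
move=> y; rewrite inE => /orP[/eqP ->|/Lt [m mM tm]].
  exists m0; first by rewrite -ltnS.
  by rewrite big_cons /= eqxx /g subrK.
exists m => //; apply/eqP; rewrite eq_le; apply/andP; split.
  exact: Lw'.
by rewrite -tm big_cons; case: ifP => // _; rewrite lerDr.
Qed.

(** The maximal saturated cells cover [D] and are pairwise disjoint, and the weight of each is the
    mass it carries. *)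
Lemma content_le_mass (M : nat) (S : seq T) (L : seq (T * R)) (D : set T) :
  (forall p, p \in L -> 0 <= p.2) ->
  (forall x, x \in S -> exists2 m, (m <= M)%N &
      \sum_(p <- L | lev m p.1 == lev m x) p.2 = w m) ->
  (forall x, D x -> exists2 y, y \in S & lev M x = lev M y) ->
  content_le lev w D (\sum_(p <- L) p.2).
Proof.
move=> Lp Lt net.
pose tight m x := \sum_(p <- L | lev m p.1 == lev m x) p.2 == w m.
exists [set q | exists x, [/\ lev q.1 x = q.2, tight q.1 x &
  forall m, (m < q.1)%N -> ~~ tight m x]]; split.
  move=> x /net [y yS xy]; have [m0 mM tm] := Lt _ yS.
  have ex : exists m, tight m x.
    by exists m0; rewrite /tight (lev_le levS mM xy) tm.
  case: (ex_minnP ex) => m tm' mmin; exists m, x; split => //= m' m'm.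
  by apply/negP => /mmin; rewrite leqNgt m'm.
move=> s us sU.
have -> : \sum_(q <- s) w q.1 =
    \sum_(p <- L) \sum_(q <- s | lev q.1 p.1 == q.2) p.2.
  rewrite (exchange_big_dep xpredT) //= big_seq [RHS]big_seq; apply: eq_bigr => q /sU.
  by move=> [x [<- /eqP <- _]].
rewrite big_seq [leRHS]big_seq; apply: ler_sum => p pL.
(* A point lies in at most one maximal saturated cell: of two such cells the larger would contradict
   the maximality of the smaller. *)
rewrite big_const_seq iter_addr_0 -size_filter.
case E : [seq q <- s | lev q.1 p.1 == q.2] => [|q1 [|q2 r]] /=; rewrite ?mulr0n ?mulr1n ?Lp //.
have : q1 \in [seq q <- s | lev q.1 p.1 == q.2] by rewrite E inE eqxx.
have : q2 \in [seq q <- s | lev q.1 p.1 == q.2] by rewrite E !inE eqxx orbT.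
rewrite !mem_filter => /andP[/eqP e2 /sU[x2 [x2q t2 m2]]].
move=> /andP[/eqP e1 /sU[x1 [x1q t1 m1]]].
have trans m q x : (m <= q.1)%N -> lev q.1 x = q.2 -> lev q.1 p.1 = q.2 ->
    tight m x = tight m p.1.
  by move=> mq xq pq; rewrite /tight (lev_le levS mq (y:=p.1)) // xq pq.
have : uniq [seq q <- s | lev q.1 p.1 == q.2] by rewrite filter_uniq.
rewrite E /= inE negb_or -andbA => /andP[/eqP ne _]; case: ne.
have [lt|gt|eq] := ltngtP q1.1 q2.1.
- move: (m2 _ lt); rewrite (trans _ q2) 1?ltnW //.
  by move: t1; rewrite (trans _ q1) // => ->.
- move: (m1 _ gt); rewrite (trans _ q1) 1?ltnW //.
  by move: t2; rewrite (trans _ q2) // => ->.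
by rewrite [q1]surjective_pairing [q2]surjective_pairing -e1 -e2 eq.
Qed.

End Frostman.

(** * Suslin schemes and capacitability *)

Section Schemes.

(** Dependent choice, one term at a time. As [P n] only sees the first [n] terms, the diagonal of
    the successive approximations satisfies every [P n]. *)
Lemma seq_choice (P : nat -> (nat -> nat) -> Prop) :
  (forall n f g, (forall i, (i < n)%N -> f i = g i) -> P n f -> P n g) ->
  (exists f, P 0%N f) ->
  (forall n f, P n f -> exists g, (forall i, (i < n)%N -> g i = f i) /\ P n.+1 g) ->
  exists f, forall n, P n f.
Proof.
move=> Pext [f0 P0] Pstep.
have /choice [F FP] (nf : nat * (nat -> nat)) : exists g, P nf.1 nf.2 ->
    (forall i, (i < nf.1)%N -> g i = nf.2 i) /\ P nf.1.+1 g.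
  have [/Pstep [g gP]|nP] := pselect (P nf.1 nf.2); first by exists g.
  by exists f0.
pose G := fix G n := if n is n'.+1 then F (n', G n') else f0.
have PG n : P n (G n) by elim: n => [//|n IH]; exact: (FP (n, G n) IH).2.
have Gagree n m i : (i < n)%N -> (n <= m)%N -> G m i = G n i.
  move=> lin /subnK <-; elim: (m - n)%N => [//|k IH].
  rewrite -IH addSn /= (FP (_, _) (PG _)).1 //=.
  exact: leq_trans lin (leq_addl _ _).
exists (fun i => G i.+1 i) => n; apply: Pext (PG n) => i lin.
exact: Gagree.
Qed.

(** König's lemma for the finitely branching tree of sequences bounded by [m]: without a uniform
    depth there would be an infinite branch avoiding [B]. *)
Lemma fan_uniform (m : nat -> nat) (B : nat -> (nat -> nat) -> Prop) :
  (forall n f g, (forall i, (i < n)%N -> f i = g i) -> B n f -> B n g) ->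
  (forall n f, B n f -> B n.+1 f) ->
  (forall f, (forall i, (f i <= m i)%N) -> exists n, B n f) ->
  exists n, forall f, (forall i, (i < n)%N -> (f i <= m i)%N) -> B n f.
Proof.
move=> Bext BS Bbar; apply: contrapT => nB.
have Ble n k f : (n <= k)%N -> B n f -> B k f.
  by move=> /subnK <-; elim: (_ - _)%N => [//|j IH] /IH /BS.
(* The node given by the first [n] terms of [f] has descendants outside [B] at every depth. *)
pose P n f := forall J, exists g, [/\ forall i, (i < n)%N -> g i = f i,
  forall i, (i < J)%N -> (g i <= m i)%N & ~ B J g].
have [] := @seq_choice P.
- move=> n f g fg Pf J; have [h [hf hm nBh]] := Pf J; exists h; split => // i lin.
  by rewrite hf // fg.
- exists (fun=> 0%N) => J; apply: contrapT => nex; apply: nB; exists J => f fm.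
  by apply: contrapT => nBf; apply: nex; exists f.
- move=> n f Pf; pose upd v := fun i => if i == n then v else f i.
  have [[v Pv]|nv] := pselect (exists v, P n.+1 (upd v)).
    exists (upd v); split => // i lin; by rewrite /upd ltn_eqF.
  have /choice [J JP] v : exists J, ~ exists g,
      [/\ forall i, (i < n.+1)%N -> g i = upd v i,
          forall i, (i < J)%N -> (g i <= m i)%N & ~ B J g].
    by apply: contrapT => nJ; apply: nv; exists v => J; apply: contrapT => ?;
       apply: nJ; exists J.
  (* This depth exceeds [n], so that [g n] is bounded by [m n], and it reaches the depth at which
     each of the finitely many children fails. *)
  have [g [gf gm nBg]] := Pf (maxn n.+1 (\max_(v < (m n).+1) J v)).
  have gn : (g n < (m n).+1)%N by rewrite ltnS gm // leq_maxl.
  have Jle : (J (g n) <= maxn n.+1 (\max_(v < (m n).+1) J v))%N.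
    by rewrite leq_max (leq_bigmax (Ordinal gn)) orbT.
  case: (JP (g n)); exists g; split => [i|i iJ|/(Ble _ _ _ Jle)//].
    rewrite /upd ltnS leq_eqVlt; case: eqP => [-> //|_ /=]; exact: gf.
  by apply: gm; exact: leq_trans iJ Jle.
move=> f Pf; have fm i : (f i <= m i)%N.
  by have [g [<- // gm _]] := Pf i.+1 i.+1; exact: gm.
have [n Bf] := Bbar f fm; have [g [gf _]] := Pf n n; apply.
by apply: Bext Bf => i /gf.
Qed.

End Schemes.

Section Capacitability.
Context {R : realType} {T : Type} {K : eqType}.
Variables (lev : nat -> T -> K) (w : nat -> R).
Hypothesis levS : forall m x y, lev m.+1 x = lev m.+1 y -> lev m x = lev m y.

(** The bounds [m n] are chosen successively: the sets with [n]-th term at most [v] increase with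
    [v], so continuity along increasing sets yields a bound at a cost of [e n - e n.+1]. The costs
    sum to [c0 - c]. *)
Lemma content_capacitable (C : nat -> (nat -> nat) -> set T) (c c0 : R) :
  c < c0 -> ~ content_le lev w [set x | exists f, forall n, C n f x] c0 ->
  exists m : nat -> nat, forall j, ~ content_le lev w
    [set x | exists f, (forall i, (i < j)%N -> (f i <= m i)%N) /\ C j f x] c.
Proof.
move=> cc0 nX.
pose X j (m : nat -> nat) : set T :=
  [set x | exists f, (forall i, (i < j)%N -> (f i <= m i)%N) /\ forall n, C n f x].
pose e j := (c0 - c) / 2 ^+ j.
have e0 j : 0 < e j by rewrite divr_gt0 ?subr_gt0 ?exprn_gt0.
have [] := @seq_choice (fun j m => ~ content_le lev w (X j m) (c + e j)).
- move=> n f g fg; apply: contra_not; apply: content_leW => // x.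
  by move=> [h [hf hC]]; exists h; split => // i lin; rewrite -fg // hf.
- exists (fun=> 0%N); apply: contra_not nX.
  apply: content_leW; last by rewrite /e expr0 divr1; lra.
  by move=> x [f fC]; exists f.
- move=> n m; apply: contra_notP => nex.
  pose upd v := fun i => if i == n then v else m i.
  have cv v : content_le lev w (X n.+1 (upd v)) (c + e n.+1).
    apply: contrapT => ncl; apply: nex; exists (upd v); split => // i lin.
    by rewrite /upd ltn_eqF.
  have := content_le_bigcup levS _ cv (e0 n.+1).
  have -> : c + e n.+1 + e n.+1 = c + e n.
    by rewrite /e exprS; field; rewrite expf_neq0.
  move=> h; apply: content_leW (h _) => //.
    move=> x [f [fm fC]]; exists (f n) => //; exists f; split => // i.
    by rewrite ltnS leq_eqVlt /upd; case: eqP => [->|_ /=]; [|exact: fm].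
  move=> v x [f [fm fC]]; exists f; split => // i /fm; rewrite /upd.
  by case: eqP => // _ /leq_trans; apply.
move=> m mP; exists m => j; apply: contra_not (mP j).
apply: content_leW; last by rewrite lerDl ltW.
by move=> x [f [fm fC]]; exists f.
Qed.

End Capacitability.

(** * Borel sets are Suslin *)

Section Suslin.
Context {V : topologicalType}.

Definition suslin (X : set V) := exists C : nat -> (nat -> nat) -> set V,
  [/\ forall n f, closed (C n f),
      forall n f g, (forall i, (i < n)%N -> f i = g i) -> C n f = C n g,
      forall n f, C n.+1 f `<=` C n f &
      X = [set x | exists f, forall n, C n f x]].

Lemma suslin_closed (X : set V) : closed X -> suslin X.
Proof.
move=> clX; exists (fun _ _ => X); split=> [//|//|n f x //|]; apply/seteqP; split => x.
  by move=> Xx; exists (fun=> 0%N).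
by move=> [f /(_ 0%N)].
Qed.

(** The first term of a witness selects the set, the remaining terms are a witness for that set. *)
Lemma suslin_bigcup (X : nat -> set V) : (forall i, suslin (X i)) ->
  suslin (\bigcup_i X i).
Proof.
move=> /choice [C CP].
exists (fun n f => if n is n'.+1 then C (f 0%N) n' (f \o S) else setT); split.
- by move=> [|n] f; [exact: closedT|case: (CP (f 0%N))].
- move=> [|n] f g fg //; rewrite fg //; case: (CP (g 0%N)) => _ ext _ _.
  by apply: ext => i lin; exact: fg.
- by move=> [|n] f x //; case: (CP (f 0%N)) => _ _ dec _; exact: dec.
apply/seteqP; split => x.
  move=> [i _]; case: (CP i) => _ _ _ -> [f fC].
  by exists (fun j => if j is j'.+1 then f j' else i) => -[|n].
move=> [f fC]; exists (f 0%N) => //; case: (CP (f 0%N)) => _ _ _ ->.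
by exists (f \o S) => n; exact: (fC n.+1).
Qed.

(* A witness [f] for the intersection interleaves witnesses for all the [X i]:
   the one for [X i] is read at the positions [pickle (i, l)]. *)
Lemma suslin_bigcap (X : nat -> set V) : (forall i, suslin (X i)) ->
  suslin (\bigcap_i X i).
Proof.
move=> /choice [C CP].
pose code (i l : nat) : nat := pickle (i, l).
pose D n : set (nat * nat) := [set ij |
  forall l, (l < ij.2)%N -> (code ij.1 l < n)%N].
exists (fun n f => \bigcap_(ij in D n) C ij.1 ij.2 (fun l => f (code ij.1 l))).
split.
- by move=> n f; apply: closed_bigI => ij _; case: (CP ij.1).
- move=> n f g fg; apply: eq_bigcapr => -[i j] /= Dij.
  case: (CP i) => _ ext _ _; apply: ext => l /Dij; exact: fg.
- move=> n f x fC ij Dij; apply: fC => l /Dij; exact: ltnW.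
apply/seteqP; split => x.
  move=> Xx.
  have /choice [f fP] i : exists f, forall n, C i n f x.
    by have := Xx i I; case: (CP i) => _ _ _ ->.
  exists (fun c => if unpickle c is Some (i, l) then f i l else 0%N).
  move=> n [i j] _ /=; rewrite [X in C i j X](_ : _ = f i) //.
  by apply/funext => l; rewrite /code pickleK.
move=> [f fC] i _; case: (CP i) => _ _ _ ->.
exists (fun l => f (code i l)) => n.
apply: (fC (\max_(l < n) (code i l)).+1 (i, n)) => l /= ln.
by rewrite ltnS (leq_bigmax (Ordinal ln)).
Qed.

End Suslin.

Lemma suslin_open {R : realType} {V : normedModType R} (U : set V) :
  open U -> suslin U.
Proof.
move=> oU.
(* The points at distance at least 1/(i+1) from the complement form a closed set. *)
have -> : U = \bigcup_i \bigcap_(y in ~` U) ~` ball y (i.+1%:R^-1 : R).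
  apply/seteqP; split => x.
    move=> Ux; have /nbhs_ballP [e /= e0 xeU] := open_nbhs_nbhs (conj oU Ux).
    exists (Num.truncn e^-1) => // y nUy /ball_sym xy; apply/nUy/xeU.
    apply: le_ball xy; rewrite invf_ple ?posrE //.
    exact/ltW/truncnS_gt.
  move=> [i _ h]; apply: contrapT => /h; apply; exact: ballxx.
apply: suslin_bigcup => i; apply: suslin_closed; apply: closed_bigI => y _.
exact/open_closedC/ball_open.
Qed.

(** The sets that are Suslin together with their complements form a sigma-algebra containing the
    open sets. *)
Lemma suslin_borel {R : realType} {d : nat} (X : set 'rV[R]_d) :
  borel_set X -> suslin X.
Proof.
suff : borel_set (m:=d) `<=` [set A : set 'rV[R]_d | suslin A /\ suslin (~` A)].
  by move=> h /h [].
apply: smallest_sub => [|U oU]; last first.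
  by split; [exact: suslin_open|apply: suslin_closed; exact: open_closedC].
split.
- split; first exact/suslin_closed/closed0.
  by rewrite setC0; exact/suslin_closed/closedT.
- by move=> A [? ?]; rewrite setTD; split; rewrite ?setCK.
- move=> A AP; split; first by apply: suslin_bigcup => i; case: (AP i).
  by rewrite setC_bigcup; apply: suslin_bigcap => i; case: (AP i).
Qed.

Lemma compact_decreasing {V : ptopologicalType} (A : set V) (C O : nat -> set V) :
  compact A -> (forall n, C n `<=` A) -> (forall n, closed (C n)) ->
  (forall n, C n.+1 `<=` C n) -> (forall n, open (O n)) ->
  (forall n, O n `<=` O n.+1) -> \bigcap_n C n `<=` \bigcup_n O n ->
  exists n, C n `<=` O n.
Proof.
move=> cA CA Ccl Cdec Oop Oinc CO.
have Cle n m : (n <= m)%N -> C m `<=` C n.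
  by move=> /subnK <-; elim: (_ - _)%N => [//|i IH] x /Cdec /IH.
have Ole n m : (n <= m)%N -> O n `<=` O m.
  by move=> /subnK <-; elim: (_ - _)%N => [//|i IH] x /IH /Oinc.
move: cA; rewrite compact_cover => /(_ nat setT (fun n => ~` C n `|` O n)).
case.
- by move=> n _; apply: openU => //; exact: closed_openC.
- move=> x Ax; have [Cx|] := pselect ((\bigcap_n C n) x).
    by have [n _ Ox] := CO _ Cx; exists n => //; right.
  by rewrite /bigcap /= => /existsNP [n /not_implyP [_ ?]]; exists n => //; left.
move=> D _ AD; exists (\max_(i <- finmap.enum_fset D) i) => x Cx.
have [i /= iD [nC|Oi]] := AD _ (CA _ _ Cx); last first.
  by apply: Ole Oi; exact: leq_bigmax_seq.
by case: nC; apply: Cle Cx; exact: leq_bigmax_seq.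
Qed.

(** * Dyadic cubes *)

Section Dyadic.
Context {R : realType}.

Lemma coord_norm {d : nat} (x : 'rV[R]_d) j : `|x 0 j| <= `|x|.
Proof.
rewrite [leRHS]/Num.norm /= mx_normrE.
by apply/bigmax_geP; right => /=; exists (0, j).
Qed.

Lemma norm_le_coord {d : nat} (x : 'rV[R]_d) (r : R) : 0 <= r ->
  (forall j, `|x 0 j| <= r) -> `|x| <= r.
Proof.
move=> r0 h; rewrite [leLHS]/Num.norm /= mx_normrE.
by apply: bigmax_le => // -[i j] _ /=; rewrite ord1.
Qed.

Lemma norm_coord_max {d : nat} (x : 'rV[R]_d) : x != 0 ->
  exists j, `|x 0 j| = `|x|.
Proof.
move=> x0; apply: contrapT => nj.
have d0 : (0 < d)%N.
  case: d x x0 {nj} => // x; suff -> : x = 0 by rewrite eqxx.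
  by apply/rowP => -[].
pose i0 := Ordinal d0.
pose j0 := [arg max_(j > i0) `|x 0 j|]%O.
apply: nj; exists j0; apply/eqP; rewrite eq_le coord_norm norm_le_coord //.
by move=> j; rewrite /j0; case: arg_maxP => // i _; exact.
Qed.

(** Index of the half-open dyadic cube of side 2^-m containing [x]. *)
Definition lev {d : nat} (m : nat) (x : 'rV[R]_d) : 'rV[int]_d :=
  \row_j Num.floor (2 ^+ m * x 0 j).

Lemma levP {d : nat} m (x y : 'rV[R]_d) : lev m x = lev m y <->
  forall j, Num.floor (2 ^+ m * x 0 j) = Num.floor (2 ^+ m * y 0 j).
Proof.
split=> [/rowP h j|h]; first by have := h j; rewrite !mxE.
by apply/rowP => j; rewrite !mxE.
Qed.

Lemma levS {d : nat} m (x y : 'rV[R]_d) :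
  lev m.+1 x = lev m.+1 y -> lev m x = lev m y.
Proof.
move=> /levP h; apply/levP => j; move: (h j); rewrite exprS -!mulrA.
move: (2 ^+ m * x 0 j) (2 ^+ m * y 0 j) => a b.
wlog ab : a b / Num.floor a < Num.floor b.
  move=> H e; have [lt|gt|//] := ltgtP (Num.floor a) (Num.floor b).
    exact: H.
  by apply/esym/H.
have two : (2 : int)%:~R = 2 :> R by [].
move=> e; have := floor_itv (2 * a); have := floor_itv (2 * b).
have := floor_itv a; have := floor_itv b; rewrite -e.
move: ab; rewrite -lezD1 -(ler_int R) !intrD.

move=> h1 /andP[h2 h3] /andP[h4 h5] /andP[h6 h7] /andP[h8 h9].
have : (2 * Num.floor b <= Num.floor (2 * b)).
  by rewrite floor_ge_int intrM two; lra.
by rewrite -e -(ler_int R) intrM two => h10; exfalso; lra.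
Qed.

Lemma lev_dist {d : nat} m (x y : 'rV[R]_d) j :
  lev m x = lev m y -> `|x 0 j - y 0 j| <= 2^-1 ^+ m.
Proof.
move=> /levP /(_ j) e; have := floor_itv (2 ^+ m * x 0 j).
have := floor_itv (2 ^+ m * y 0 j); rewrite -e !intrD.
set f := (Num.floor _)%:~R => /andP[h1 h2] /andP[h3 h4].
have m0 : 0 < 2 ^+ m :> R by rewrite exprn_gt0.
rewrite -(ler_pM2l m0) exprVn divff ?gt_eqF //.
rewrite -{1}(gtr0_norm m0) -normrM ler_norml; apply/andP; split; lra.
Qed.

(** Each coordinate of the index changes by -1, 0 or 1; the change is stored in ['I_3] shifted by
    one. *)
Lemma lev_neighbour {d : nat} m (x y : 'rV[R]_d) : `|x - y| <= 2^-1 ^+ m ->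
  exists s : {ffun 'I_d -> 'I_3},
    lev m y = \row_j (lev m x 0 j + (s j)%:Z - 1).
Proof.
move=> xy; exists [ffun j => inord `|Num.floor (2 ^+ m * y 0 j)
   - Num.floor (2 ^+ m * x 0 j) + 1|].
apply/rowP => j; rewrite !mxE ffunE.
have m0 : 0 < 2 ^+ m :> R by rewrite exprn_gt0.
have : `|2 ^+ m * x 0 j - 2 ^+ m * y 0 j| <= 1.
  rewrite -mulrBr normrM (gtr0_norm m0) -ler_pdivlMl // mulr1 -exprVn.
  by apply: le_trans xy; have := coord_norm (x - y) j; rewrite !mxE.
rewrite ler_norml => /andP[].
move: (2 ^+ m * x 0 j) (2 ^+ m * y 0 j) => a b h1 h2.
have := floor_itv a; have := floor_itv b => /andP[h3 h4] /andP[h5 h6].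
have : Num.floor a < Num.floor b + 2 by rewrite -(ltr_int R) intrD; lra.
have : Num.floor b < Num.floor a + 2 by rewrite -(ltr_int R) intrD; lra.
move=> h7 h8; rewrite inordK; lia.
Qed.

Lemma lev_finite (d m l : nat) : exists (F : finType) (h : 'rV[R]_d -> F),
  forall x y, `|x| <= l%:R -> `|y| <= l%:R -> h x = h y -> lev m x = lev m y.
Proof.
exists {ffun 'I_d -> 'I_(2 * (2 ^ m * l)).+1}.
exists (fun x => [ffun j => inord `|Num.floor (2 ^+ m * x 0 j)
  + (2 ^ m * l)%N%:Z|]).
move=> x y xl yl /ffunP h; apply/levP => j; have := h j; rewrite !ffunE.
have fl (z : 'rV[R]_d) : `|z| <= l%:R -> - (2 ^ m * l)%N%:Z <=
    Num.floor (2 ^+ m * z 0 j) /\ Num.floor (2 ^+ m * z 0 j) <= (2 ^ m * l)%N%:Z.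
  move=> zl; have := le_trans (coord_norm z j) zl; rewrite ler_norml => /andP[h1 h2].
  have m0 : 0 < 2 ^+ m :> R by rewrite exprn_gt0.
  split.
    rewrite floor_ge_int intrN -pmulrn natrM natrX -mulrN ler_pM2l //.
  rewrite -(ler_int R) (le_trans (floor_le _)) // -pmulrn natrM natrX.
  by rewrite ler_pM2l.
move=> /(congr1 val) /=.
have [x1 x2] := fl _ xl; have [y1 y2] := fl _ yl.
move: x1 x2 y1 y2.
move: (Num.floor _) (Num.floor _) (2 ^ m * l)%N => a b c x1 x2 y1 y2.
by rewrite !inordK; lia.
Qed.

Lemma exists_net {T : eqType} {F : finType} (h : T -> F) (D : set T) :
  exists S : seq T, (forall x, x \in S -> D x) /\
    forall x, D x -> exists2 y, y \in S & h x = h y.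
Proof.
have /choice [r rP] (c : F) : exists o : option T,
    if o is Some x then D x /\ h x = c else forall x, D x -> h x <> c.
  have [[x Dx]|nx] := pselect (exists x, D x /\ h x = c); first by exists (Some x).
  by exists None => x Dx hx; apply: nx; exists x.
exists (pmap r (enum F)); split.
  move=> x; rewrite mem_pmap => /mapP[c _ rc].
  by have := rP c; rewrite -rc => -[].
move=> x Dx; have := rP (h x); case E : (r (h x)) => [y|]; last by move/(_ x Dx).
move=> [Dy hy]; exists y => //.
by rewrite mem_pmap -E map_f // mem_enum.
Qed.

End Dyadic.

(** * Transversality *)

Section Counting.
Context {R : realType}.

Lemma card_ord_le {N : nat} (A : {set 'I_N}) (r : R) : 0 <= r ->
  (forall u v, u \in A -> v \in A -> (u%:R : R) - v%:R <= r) ->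
  (#|A|%:R : R) <= r + 1.
Proof.
move=> r0 Ar; have [->|[i0 i0A]] := set_0Vmem A; first by rewrite cards0; lra.
pose a := [arg min_(i < i0 in A) (i : nat)].
pose b := [arg max_(i > i0 in A) (i : nat)].
have [aA amin] : a \in A /\ forall i, i \in A -> (a <= i)%N.
  by rewrite /a; case: arg_minnP.
have [bA bmax] : b \in A /\ forall i, i \in A -> (i <= b)%N.
  by rewrite /b; case: arg_maxnP.
have : (#|A| <= b.+1 - a)%N.
  rewrite cardE -(size_map (@nat_of_ord N)) -(size_iota a (b.+1 - a)).
  apply: uniq_leq_size; first by rewrite map_inj_uniq ?enum_uniq //; exact: val_inj.
  move=> v /mapP[i]; rewrite mem_enum => iA ->; rewrite mem_iota.
  have := amin _ iA; have := bmax _ iA; clearbody a b; lia.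
have ab := amin _ bA.
rewrite -(ler_nat R) => /le_trans; apply.
by rewrite subSn // -natr1 natrB // lerD2r Ar.
Qed.

(** Fubini along the lines parallel to the [i]-th axis, each line being counted once for each of its
    [N] points. *)
Lemma card_line_le {I : finType} {N : nat} (P : pred {ffun I -> 'I_N}) (i : I)
  (r : R) :
  (forall f : {ffun I -> 'I_N},
    (#|[set v | P [ffun j => if j == i then v else f j]]%SET|%:R : R) <= r) ->
  (N%:R : R) * #|[set f | P f]%SET|%:R <= r * N%:R ^+ #|I|.
Proof.
move=> h.
pose upd (f : {ffun I -> 'I_N}) v : {ffun I -> 'I_N} :=
  [ffun j => if j == i then v else f j].
have -> : (N%:R : R) * #|[set f | P f]%SET|%:R =
    \sum_(f : {ffun I -> 'I_N}) #|[set v | P (upd f v)]%SET|%:R.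
  transitivity (\sum_(fv : {ffun I -> 'I_N} * 'I_N) (P fv.1 : nat)%:R : R).
    rewrite -(pair_bigA _ (fun f v => (P f : nat)%:R : R)) /=.
    rewrite (eq_bigr (fun f => N%:R * (P f : nat)%:R)); last first.
      by move=> f _; rewrite sumr_const card_ord mulr_natl.
    rewrite -mulr_sumr -natr_sum; congr (_ * _%:R).
    by rewrite -sum1dep_card big_mkcond; apply: eq_bigr => f _; case: (P f).
  (* This involution swaps [v] with the [i]-th coordinate of [f]. *)
  rewrite (reindex (fun fv : {ffun I -> 'I_N} * 'I_N => (upd fv.1 fv.2, fv.1 i))).
    rewrite -(pair_bigA _ (fun f v => (P (upd f v) : nat)%:R : R)) /=.
    apply: eq_bigr => f _; rewrite -natr_sum -sum1dep_card; congr (_%:R).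
    by rewrite [RHS]big_mkcond; apply: eq_bigr => v _; case: (P _).
  apply: onW_bij; apply: inv_bij => -[f v] /=; congr (_, _).
    by apply/ffunP => j; rewrite !ffunE; case: eqP => [->|].
  by rewrite ffunE eqxx.
have -> : (N%:R : R) ^+ #|I| = #|{: {ffun I -> 'I_N}}|%:R.
  by rewrite card_ffun card_ord natrX.
apply: le_trans (ler_sum _ (fun f _ => h f)) _.
by rewrite sumr_const mulr_natr.
Qed.

End Counting.

Section Transversality.
Context {R : realType} {n k : nat}.
Local Notation V := 'rV[R]_(k.+1 * n).

Lemma rowBE {d : nat} (x y : 'rV[R]_d) j : (x - y) 0 j = x 0 j - y 0 j.
Proof. by rewrite !mxE. Qed.

Lemma pi_mapE (t : 'rV[R]_k) (z : V) j : pi_map t z 0 j =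
  z 0 (mxvec_index ord0 j) + \sum_i t 0 i * z 0 (mxvec_index (lift ord0 i) j).
Proof.
rewrite /pi_map /coord_block !mxE summxE; congr (_ + _).
by apply: eq_bigr => i _; rewrite !mxE.
Qed.

Lemma pi_mapB (t : 'rV[R]_k) (x y : V) :
  pi_map t (x - y) = pi_map t x - pi_map t y.
Proof.
apply/rowP => j; rewrite rowBE !pi_mapE !rowBE.
rewrite opprD addrACA -sumrB; congr (_ + _).
by apply: eq_bigr => i _; rewrite rowBE; ring.
Qed.

Lemma pi_map_perturb (t t' : 'rV[R]_k) (z : V) (r : R) : 0 <= r ->
  (forall i, `|t 0 i - t' 0 i| <= r) ->
  `|pi_map t z| <= `|pi_map t' z| + k%:R * r * `|z|.
Proof.
move=> r0 tt'.
rewrite -lerBlDl; apply: le_trans (lerB_dist _ _) _.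
apply: norm_le_coord => [|j]; first by rewrite !mulr_ge0.
rewrite rowBE !pi_mapE opprD addrACA subrr add0r -sumrB.
apply: le_trans (ler_norm_sum _ _ _) _.
apply: le_trans (_ : _ <= \sum_(i < k) r * `|z|) _; last first.
  by rewrite sumr_const card_ord -mulrA mulr_natl.
apply: ler_sum => i _; rewrite -mulrBl normrM ler_pM // ?coord_norm //.
Qed.

Lemma pi_map_bound (t : 'rV[R]_k) (z : V) (B : R) :
  (forall i, `|t 0 i| <= B) -> 0 <= B ->
  `|pi_map t z| <= (1 + k%:R * B) * `|z|.
Proof.
move=> tB B0; have h i : `|t 0 i - (0 : 'rV[R]_k) 0 i| <= B.
  by rewrite mxE subr0.
have := pi_map_perturb z B0 h; rewrite mulrDl mul1r => /le_trans; apply.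
rewrite lerD2r; apply: norm_le_coord => // j; rewrite pi_mapE big1 => [|i _].
  by rewrite addr0 coord_norm.
by rewrite mxE mul0r.
Qed.

(** Lower corners of the dyadic cubes of side 2^-M that fill the box [-B, B)^k. *)
Definition grid (B M : nat) (f : {ffun 'I_k -> 'I_(2 * B * 2 ^ M)}) : 'rV[R]_k :=
  \row_i ((f i)%:R / 2 ^+ M - B%:R).

Lemma grid_bound B M (f : {ffun 'I_k -> 'I_(2 * B * 2 ^ M)}) i :
  `|grid f 0 i| <= B%:R.
Proof.
rewrite mxE; have m0 : 0 < 2 ^+ M :> R by rewrite exprn_gt0.
have : ((f i)%:R : R) / 2 ^+ M <= 2 * B%:R.
  by rewrite ler_pdivrMr // -natrX -!natrM ler_nat ltnW.
have : 0 <= ((f i)%:R : R) / 2 ^+ M by rewrite divr_ge0 // ltW.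
by rewrite ler_norml => ? ?; apply/andP; split; lra.
Qed.

Lemma lev_grid B M (t : 'rV[R]_k) : `|t| < B%:R ->
  exists f : {ffun 'I_k -> 'I_(2 * B * 2 ^ M)}, lev M t = lev M (grid f).
Proof.
move=> tB; have m0 : 0 < 2 ^+ M :> R by rewrite exprn_gt0.
pose c i := Num.floor (2 ^+ M * t 0 i) + (B * 2 ^ M)%N%:Z.
have cP i : (0 <= c i) && (c i < (2 * B * 2 ^ M)%N%:Z).
  have := coord_norm t i; rewrite ler_norml => /andP[h1 h2].
  rewrite /c; apply/andP; split.
    rewrite -lerBlDr sub0r floor_ge_int intrN -pmulrn natrM natrX mulrC -mulrN.
    by rewrite ler_pM2l //; lra.
  rewrite -ltrBrDr -(ltr_int R) (le_lt_trans (floor_le _)) // intrD intrN.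
  rewrite -!pmulrn !natrM natrX -mulrBl mulrC ltr_pM2r //; lra.
have cN i : (`|c i|%N < 2 * B * 2 ^ M)%N by have := cP i; lia.
exists [ffun i => Ordinal (cN i)]; apply/levP => i; rewrite !mxE !ffunE /=.
rewrite mulrBr [2 ^+ M * (_ / _)]mulrC divfK ?gt_eqF //.
have -> : (`|c i|%N)%:R = (c i)%:~R :> R.
  by rewrite pmulrn gez0_abs //; case/andP: (cP i).
have -> : 2 ^+ M * B%:R = (B * 2 ^ M)%N%:~R :> R.
  by rewrite -pmulrn natrM natrX mulrC.
by rewrite -intrB intrKfloor /c addrK.
Qed.

(* Either the block [z_0] dominates, and then |pi_t z| is comparable to |z| for
   every [t] in the box, or some coordinate of some [z_i], [i >= 1], is
   comparable to |z|, and then |pi_t z| is small only for [t_i] in a short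
   interval once the other parameters are fixed. *)
Lemma transversality (B : nat) (c l : R) : (0 < B)%N -> 0 <= c -> 0 <= l ->
  exists C : R, 0 <= C /\ forall (M m : nat) (z : V), (m <= M)%N ->
  z != 0 -> `|z| <= l ->
  (#|[set f : {ffun 'I_k -> 'I_(2 * B * 2 ^ M)} |
      `|pi_map (grid f) z| <= c * 2^-1 ^+ m]%SET|%:R : R)
    <= C * (2^-1 ^+ m / `|z|) * (2 * B * 2 ^ M)%N%:R ^+ k.
Proof.
move=> B0 c0 l0; pose kap : R := 2 * (k%:R * B%:R + 1).
have kap2 : 2 <= kap by rewrite /kap; have : 0 <= k%:R * B%:R :> R by []; lra.
(* The term [2 * c] serves the dominant block [z_0], [2 * c * kap] the length of the interval of
   [t_i], and [l] the extra grid point that such an interval may contain. *)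
exists (2 * c + 2 * c * kap + l); split.
  by rewrite !addr_ge0 ?mulr_ge0 //; lra.
move=> M m z mM z0 zl; set N := (2 * B * 2 ^ M)%N.
have zp : 0 < `|z| by rewrite normr_gt0.
have x0 : 0 < 2^-1 ^+ m :> R by rewrite exprn_gt0.
have N1 : 1 <= N%:R :> R.
  by rewrite ler1n /N !muln_gt0 B0 expn_gt0.
have Nk0 : 0 <= N%:R ^+ k :> R by rewrite exprn_ge0 // (le_trans ler01).
have m0 : 0 < 2 ^+ M :> R by rewrite exprn_gt0.
set y := 2^-1 ^+ m / `|z|.
have y0 : 0 < y by rewrite divr_gt0.
have [big|small] := pselect (exists i j,
    `|z| <= kap * `|z 0 (mxvec_index (lift ord0 i) j)|); last first.
  have sm i j : `|z 0 (mxvec_index (lift ord0 i) j)| <= `|z| / kap.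
    rewrite ler_pdivlMr; last by lra.
    by rewrite leNgt mulrC; apply/negP => /ltW h; apply: small; exists i, j.
  have [q qz] := norm_coord_max z0.
  case: (mxvec_indexP q) qz => i j qz.
  have i0 : i = ord0.
    case: (unliftP ord0 i) => [i' iE|//]; case: small; exists i', j.
    by rewrite -iE qz ler_peMl //; lra.
  rewrite {}i0 in qz.
  have half (f : {ffun 'I_k -> 'I_N}) : `|z| / 2 <= `|pi_map (grid f) z|.
    apply: le_trans (coord_norm _ j); rewrite pi_mapE.
    set s := \sum__ _.
    have sB : `|s| <= `|z| / 2.
      apply: le_trans (ler_norm_sum _ _ _) _.
      apply: le_trans (_ : _ <= \sum_(i < k) B%:R * (`|z| / kap)) _.
        apply: ler_sum => i' _; rewrite normrM ler_pM ?grid_bound //; exact: sm.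
      rewrite sumr_const card_ord -[leLHS]mulr_natl.
      have -> : `|z| / 2 = (kap / 2) * (`|z| / kap) by field; lra.
      rewrite mulrA ler_wpM2r // ?divr_ge0 // ?(ltW zp) //; first lra.
      by rewrite /kap; lra.
    have := lerB_normD (z 0 (mxvec_index ord0 j)) s; rewrite qz; lra.
  (* Either the claimed bound exceeds the number of grid points, or |z| / 2 > c 2^-m and no
     parameter qualifies. *)
  have [yc|yc] := leP (1 : R) (2 * c * y).
    apply: le_trans (_ : _ <= 1 * N%:R ^+ k) _.
      rewrite mul1r -natrX ler_nat (leq_trans (max_card _)) //.
      by rewrite card_ffun !card_ord.
    rewrite ler_wpM2r // (le_trans yc) // ler_wpM2r ?(ltW y0) //.
    by rewrite -addrA lerDl addr_ge0 ?mulr_ge0 //; lra.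
  rewrite (_ : #|_| = 0%N); last first.
    apply/eqP; rewrite cards_eq0; apply/eqP/setP => f; rewrite !inE.
    apply/negbTE; rewrite -ltNge.
    apply: lt_le_trans (half f); rewrite ltr_pdivlMr //.
    by move: yc; rewrite /y mulrA ltr_pdivrMr // mul1r; lra.
  by rewrite !mulr_ge0 // ?(ltW y0) // !addr_ge0 ?mulr_ge0 //; lra.
have [i [j zij]] := big.
set a := z 0 (mxvec_index (lift ord0 i) j) in zij.
have a0 : 0 < `|a|.
  have : 0 < kap * `|a| by exact: lt_le_trans zp zij.
  by rewrite pmulr_rgt0 //; lra.
have line (f : {ffun 'I_k -> 'I_N}) :
  (#|[set v | `|pi_map (grid ([ffun j => if j == i then v else f j] :
      {ffun 'I_k -> 'I_N})) z| <= c * 2^-1 ^+ m]%SET|%:R : R)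
    <= (2 * c * kap + l) * y * 2 ^+ M.
  apply: le_trans (_ : _ <= 2 * c * 2^-1 ^+ m / `|a| * 2 ^+ M + 1) _.
    apply: card_ord_le => [|u v].
      by rewrite !mulr_ge0 // ?invr_ge0 // ltW.
    rewrite !inE => hu hv.
    rewrite -ler_pdivrMr // ler_pdivlMr //.
    apply: le_trans (_ : _ <= `|((u%:R - v%:R) / 2 ^+ M) * a|) _.
      by rewrite normrM ler_wpM2r // ler_norm.
    have -> : ((u%:R - v%:R) / 2 ^+ M) * a =
        pi_map (grid ([ffun j => if j == i then u else f j] :
          {ffun 'I_k -> 'I_N})) z 0 j -
        pi_map (grid ([ffun j => if j == i then v else f j] :
          {ffun 'I_k -> 'I_N})) z 0 j.
      rewrite !pi_mapE opprD addrACA subrr add0r -sumrB (bigD1 i) //=.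
      rewrite big1 => [|i' i'i]; last first.
        by rewrite !mxE !ffunE (negbTE i'i) subrr.
      by rewrite addr0 !mxE !ffunE eqxx /a; ring.
    apply: le_trans (ler_normB _ _) _.
    have := le_trans (coord_norm _ j) hu; have := le_trans (coord_norm _ j) hv.
    lra.
  rewrite [(_ + l) * y]mulrDl [_ * 2 ^+ M in leRHS]mulrDl lerD //.
    have key : `|a|^-1 <= kap / `|z|.
      by rewrite -[leLHS]mul1r ler_pdivrMr // mulrAC ler_pdivlMr ?mul1r.
    rewrite ler_wpM2r ?(ltW m0) //.
    have -> : 2 * c * kap * y = 2 * c * 2^-1 ^+ m * (kap / `|z|).
      by rewrite /y; ring.
    by rewrite ler_wpM2l // !mulr_ge0 // ltW.
  rewrite /y mulrA mulrAC ler_pdivlMr // mul1r (le_trans zl) //.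
  rewrite -mulrA ler_peMr // exprVn mulrC ler_pdivlMr ?exprn_gt0 // mul1r.
  by rewrite ler_weXn2l // ler1n.
have := @card_line_le R _ _
  (fun f => `|pi_map (grid f) z| <= c * 2^-1 ^+ m) i _ line.
rewrite card_ord -/N => h.
have h2 : (2 ^+ M : R) <= N%:R.
  by rewrite -natrX ler_nat /N leq_pmull // muln_gt0 B0.
rewrite -(ler_pM2l (lt_le_trans ltr01 N1)); apply: le_trans h _.
rewrite [leRHS]mulrA ler_wpM2r // [leLHS]mulrC; apply: ler_pM.
- exact: ltW.
- by rewrite mulr_ge0 ?(ltW y0) // addr_ge0 // !mulr_ge0 //; lra.
- exact: h2.
rewrite ler_wpM2r ?(ltW y0) //; lra.
Qed.

End Transversality.

(** * Energies *)

Section Energy.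
Context {R : realType}.

Definition correlation {V W : normedModType R} (p : V -> W) (r : R)
    (L : seq (V * R)) : R :=
  \sum_(a <- L) \sum_(b <- L) a.2 * b.2 * (`|p a.1 - p b.1| <= r)%R%:R.

(** For u = 2^-s with s > 0 this is, up to constants, the s-energy of the image under [p] of the
    measure [L], truncated at scale 2^-M. *)
Definition energy {V W : normedModType R} (p : V -> W) (u c : R) (M : nat)
    (L : seq (V * R)) : R :=
  \sum_(m < M.+1) u^-1 ^+ m * correlation p (c * 2^-1 ^+ m) L.

Lemma ler_energy {V W : normedModType R} (p p' : V -> W) (u c c' : R) M L :
  0 < u -> (forall a, a \in L -> 0 <= a.2) ->
  (forall m a b, (m <= M)%N -> a \in L -> b \in L ->
     `|p a.1 - p b.1| <= c * 2^-1 ^+ m -> `|p' a.1 - p' b.1| <= c' * 2^-1 ^+ m) ->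
  energy p u c M L <= energy p' u c' M L.
Proof.
move=> u0 L0 h; apply: ler_sum => m _; rewrite ler_wpM2l ?exprn_ge0 ?invr_ge0 ?(ltW u0) //.
rewrite /correlation big_seq [leRHS]big_seq; apply: ler_sum => a aL.
rewrite big_seq [leRHS]big_seq; apply: ler_sum => b bL.
rewrite ler_wpM2l ?mulr_ge0 ?L0 // ler_nat.
have := h m a b (ltn_ord m) aL bL.
by case: (`|p a.1 - p b.1| <= _) => // /(_ isT) ->.
Qed.

(* The points are assigned to disjoint classes of diameter 2^-m_i; with A_i the
   mass of the i-th class, A_i <= (la A_i^2 u^-m_i + u^m_i / la) / 2 by AM-GM,
   to be summed over i with la = eps / c. *)
Lemma energy_lower_bound {V W : normedModType R} (p : V -> W) (u c eps : R)
    (M N : nat) (L : seq (V * R)) (y : nat -> W) (m : nat -> nat) :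
  0 < u -> 0 < c -> 0 < eps -> (forall a, a \in L -> 0 <= a.2) ->
  c <= \sum_(a <- L) a.2 ->
  (forall a, a \in L -> exists i, [/\ (i < N)%N, (m i <= M)%N &
     `|p a.1 - y i| < 2^-1 ^+ (m i).+1]) ->
  \sum_(i < N) u ^+ m i <= eps ->
  c ^+ 2 / eps <= energy p u 1 M L.
Proof.
move=> u0 c0 e0 L0 cL cov sume.
have /choice [z zP] (a : V * R) : exists i, a \in L -> [/\ (i < N)%N,
    (m i <= M)%N & `|p a.1 - y i| < 2^-1 ^+ (m i).+1].
  by have [/cov [i ?]|_] := boolP (a \in L); [exists i|exists 0%N].
pose A (i : nat) := \sum_(a <- L | z a == i) a.2.
have LA : \sum_(a <- L) a.2 = \sum_(i < N) A i.
  rewrite /A (exchange_big_dep xpredT) //= big_seq [RHS]big_seq.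
  apply: eq_bigr => a /zP [zN _ _].
  by rewrite (big_pred1 (Ordinal zN)).
(* For a pair in one class only the term of index [m (z a)] is kept: both images are within 2^-(m+1)
   of the same centre. *)
have sq : \sum_(i < N) A i ^+ 2 * u^-1 ^+ m i <= energy p u 1 M L.
  have -> : energy p u 1 M L = \sum_(a <- L) \sum_(b <- L) a.2 * b.2 *
     \sum_(j < M.+1) u^-1 ^+ j * (`|p a.1 - p b.1| <= 1 * 2^-1 ^+ j)%R%:R.
    rewrite /energy /correlation.
    under eq_bigr do rewrite mulr_sumr.
    rewrite exchange_big; apply: eq_bigr => a _.
    under eq_bigr do rewrite mulr_sumr.
    rewrite exchange_big; apply: eq_bigr => b _.
    by rewrite mulr_sumr; apply: eq_bigr => j _; ring.
  have -> : \sum_(i < N) A i ^+ 2 * u^-1 ^+ m i =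
      \sum_(a <- L) \sum_(b <- L | z b == z a) a.2 * b.2 * u^-1 ^+ m (z a).
    transitivity (\sum_(i < N) \sum_(a <- L | z a == i)
       \sum_(b <- L | z b == z a) a.2 * b.2 * u^-1 ^+ m (z a)).
      apply: eq_bigr => i _; rewrite expr2 {1}/A !mulr_suml.
      apply: eq_bigr => a /eqP ->; rewrite /A mulr_sumr mulr_suml.
      by apply: eq_bigr.
    rewrite (exchange_big_dep xpredT) //= big_seq [RHS]big_seq.
    apply: eq_bigr => a /zP [zN _ _].
    by rewrite (big_pred1 (Ordinal zN)).
  rewrite big_seq [leRHS]big_seq; apply: ler_sum => a aL.
  rewrite big_mkcond big_seq [leRHS]big_seq; apply: ler_sum => b bL.
  have t0 (j : 'I_M.+1) :
      0 <= u^-1 ^+ j * (`|p a.1 - p b.1| <= 1 * 2^-1 ^+ j)%R%:R.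
    by rewrite mulr_ge0 // exprn_ge0 // invr_ge0 ltW.
  case: eqP => [zba|_]; last first.
    by rewrite mulr_ge0 ?sumr_ge0 // mulr_ge0 // L0.
  rewrite ler_wpM2l ?mulr_ge0 ?L0 //.
  have [_ mM ya] := zP _ aL; have [_ _ yb] := zP _ bL.
  rewrite (bigD1 (Ordinal (mM : (_ < M.+1)%N))) //= ler_wpDr ?sumr_ge0 //.
  suff -> : `|p a.1 - p b.1| <= 1 * 2^-1 ^+ m (z a) by rewrite mulr1.
  rewrite zba in yb; rewrite mul1r.
  apply: le_trans (ler_distD (y (z a)) _ _) _.
  rewrite [X in _ + X]distrC; move: ya yb; rewrite exprS; lra.
pose la := eps / c.
have la0 : 0 < la by rewrite divr_gt0.
have amgm i : 2 * A i <= la * (A i ^+ 2 * u^-1 ^+ m i) + u ^+ m i / la.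
  have um : 0 < u ^+ m i by rewrite exprn_gt0.
  have : 0 <= (la * A i - u ^+ m i) ^+ 2 / (la * u ^+ m i).
    by rewrite divr_ge0 ?sqr_ge0 // mulr_ge0 // ltW.
  rewrite exprVn.
  have -> : (la * A i - u ^+ m i) ^+ 2 / (la * u ^+ m i) =
     la * (A i ^+ 2 / u ^+ m i) + u ^+ m i / la - 2 * A i.
    by field; rewrite !gt_eqF.
  lra.
have : 2 * c <= la * energy p u 1 M L + c.
  apply: le_trans (_ : _ <= 2 * \sum_(i < N) A i) _; first by rewrite -LA; lra.
  rewrite mulr_sumr; apply: le_trans (ler_sum _ (fun (i : 'I_N) _ => amgm i)) _.
  rewrite big_split /= -mulr_sumr -mulr_suml lerD // ?ler_wpM2l // ?(ltW la0) //.
  by rewrite ler_pdivrMr // /la mulrCA divff ?gt_eqF // mulr1.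
have -> : c ^+ 2 / eps = c / la by rewrite /la; field; rewrite !gt_eqF.
by rewrite ler_pdivrMr // [_ * la]mulrC; lra.
Qed.

Lemma sum_arith_geom_le (r : R) M : 0 <= r -> r < 1 ->
  \sum_(m < M) m.+1%:R * r ^+ m <= (1 - r) ^- 2.
Proof.
move=> r0 r1.
have e : (\sum_(m < M) m.+1%:R * r ^+ m) * (1 - r) ^+ 2 =
    1 - (M%:R + 1) * r ^+ M + M%:R * r ^+ M.+1.
  elim: M => [|M IH]; first by rewrite big_ord0 /= !expr0; ring.
  by rewrite big_ord_recr /= mulrDl IH -!natr1 !exprS; ring.
rewrite -[leRHS]mul1r ler_pdivlMr; last by rewrite exprn_gt0 // subr_gt0.
rewrite e exprS.
have : 0 <= r ^+ M by rewrite exprn_ge0.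
have : 0 <= M%:R * r ^+ M * (1 - r) by rewrite !mulr_ge0 ?exprn_ge0 // subr_ge0 ltW.
lra.
Qed.

End Energy.

(** * Averages of energies over the grid of parameters *)

Section EnergyAverage.
Context {R : realType} {n k : nat}.
Local Notation d := (k.+1 * n)%N.
Local Notation V := 'rV[R]_(k.+1 * n).

(** A sup-norm ball of radius 2^-j is covered by 3^d dyadic cubes of side 2^-j. *)
Lemma ball_mass (w : nat -> R) (M j : nat) (L : seq (V * R)) (x : V) :
  (forall a, a \in L -> 0 <= a.2) ->
  (forall c, \sum_(a <- L | lev j a.1 == c) a.2 <= w j) ->
  \sum_(a <- L) a.2 * (`|x - a.1| <= 2^-1 ^+ j)%R%:R <= 3 ^+ d * w j.
Proof.
move=> L0 Lw.
pose sh (s : {ffun 'I_d -> 'I_3}) : 'rV[int]_d :=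
  \row_i (lev j x 0 i + (s i)%:Z - 1).
apply: le_trans (_ : _ <= \sum_s \sum_(a <- L | lev j a.1 == sh s) a.2) _.
  under [leRHS]eq_bigr do rewrite big_mkcond.
  rewrite exchange_big big_seq [leRHS]big_seq; apply: ler_sum => a aL /=.
  have t0 s : 0 <= (if lev j a.1 == sh s then a.2 else 0).
    by case: ifP => // _; exact: L0.
  have [xa|_] := boolP (`|x - a.1| <= 2^-1 ^+ j); last first.
    by rewrite mulr0 sumr_ge0.
  have [s sE] := lev_neighbour xa.
  by rewrite mulr1 (bigD1 s) //= {1}sE eqxx lerDl sumr_ge0.
apply: le_trans (ler_sum _ (fun s _ => Lw _)) _.
by rewrite sumr_const card_ffun !card_ord -[leLHS]mulr_natl natrX.
Qed.

(** By transversality, the average over [t] of the indicator of |pi_t z| <= c 2^-m is dominated by a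
    kernel of size min(1, 2^-m / |z|). Its integral against the measure is O((m+1) v^m), because
    [2^-1 <= v]; after weighting by u^-m the series converges as [v < u]. *)
Lemma energy_average (B l : nat) (u v c : R) : (0 < B)%N -> 0 <= c ->
  2^-1 <= v -> v < u -> exists C : R, 0 <= C /\
  forall (M : nat) (L : seq (V * R)),
  (forall a, a \in L -> 0 <= a.2 /\ `|a.1| <= l%:R) ->
  (forall m b, (m <= M)%N -> \sum_(a <- L | lev m a.1 == b) a.2 <= v ^+ m) ->
  \sum_(f : {ffun 'I_k -> 'I_(2 * B * 2 ^ M)})
     energy (@pi_map R n k (grid f)) u c M L <= C * (2 * B * 2 ^ M)%N%:R ^+ k.
Proof.
move=> B0 c0 v2 vu.
have [C [C0 CP]] := @transversality R n k B c (2 * l%:R) B0 c0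
  (mulr_ge0 (ler0n _ 2) (ler0n _ l)).
have [F [h hP]] := @lev_finite R d 0 l.
have v0 : 0 < v by apply: lt_le_trans v2; rewrite invr_gt0.
have u0 : 0 < u by exact: lt_trans vu.
pose D1 : R := 2 * (C + 1) * 3 ^+ d + C * #|F|%:R.
have D10 : 0 <= D1.
  by rewrite addr_ge0 ?mulr_ge0 ?exprn_ge0 // addr_ge0.
pose r := v / u.
have r0 : 0 <= r by rewrite divr_ge0 // ltW.
have r1 : r < 1 by rewrite ltr_pdivrMr // mul1r.
exists (#|F|%:R * D1 * (1 - r) ^- 2); split.
  by rewrite !mulr_ge0 // invr_ge0 exprn_ge0 // subr_ge0 ltW.
move=> M L LP Lv; set N := (2 * B * 2 ^ M)%N.
have L0 a : a \in L -> 0 <= a.2 by move=> /LP [].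
(* At most [#|F|] unit cubes meet the ball of radius [l], and each has mass at most v^0 = 1. *)
have total : \sum_(a <- L) a.2 <= #|F|%:R.
  rewrite (partition_big (fun a => h a.1) xpredT) //=.
  apply: le_trans (_ : _ <= \sum_(b : F) 1) _; last first.
    by rewrite sumr_const.
  apply: ler_sum => b _.
  have [[a aL hab]|nb] := pselect (exists2 a, a \in L & h a.1 = b); last first.
    rewrite big_seq_cond big1 ?ler01 // => a /andP[aL /eqP hab].
    by case: nb; exists a.
  have := Lv 0%N (lev 0 a.1) isT; rewrite expr0; apply: le_trans.
  rewrite big_mkcond [leRHS]big_mkcond big_seq [leRHS]big_seq /=.
  apply: ler_sum => a' aL'; case: eqP => ha'.
    rewrite (hP a'.1 a.1) ?eqxx ?(LP _ aL').2 ?(LP _ aL).2 //; by rewrite ha'.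
  by case: ifP => // _; exact: L0.
have N0 : 0 <= N%:R ^+ k :> R by rewrite exprn_ge0.
have half0 m : 0 < 2^-1 ^+ m :> R by rewrite exprn_gt0.
(* Dyadic majorant: the sum handles |z| <= 1 by dyadic annuli, the last term handles |z| > 1. With
   [C + 1] the coefficient is at least 1, as the trivial bound for |z| <= 2^-m requires. *)
pose kern m (z : V) : R :=
  2 * (C + 1) * \sum_(j < m.+1) 2^-1 ^+ (m - j) * (`|z| <= 2^-1 ^+ j)%R%:R
  + C * 2^-1 ^+ m.
have kernP (m : nat) (z : V) : (m <= M)%N -> `|z| <= 2 * l%:R ->
    \sum_(f : {ffun 'I_k -> 'I_N}) (`|pi_map (grid f) z| <= c * 2^-1 ^+ m)%R%:R
      <= kern m z * N%:R ^+ k.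
  move=> mM zl.
  have -> : \sum_(f : {ffun 'I_k -> 'I_N})
      (`|pi_map (grid f) z| <= c * 2^-1 ^+ m)%R%:R =
      #|[set f : {ffun 'I_k -> 'I_N} |
         `|pi_map (grid f) z| <= c * 2^-1 ^+ m]%SET|%:R :> R.
    rewrite -natr_sum -sum1dep_card; congr (_%:R).
    by rewrite [RHS]big_mkcond; apply: eq_bigr => f _; case: (`|_| <= _).
  have t0 (j : 'I_m.+1) : 0 <= 2^-1 ^+ (m - j) * (`|z| <= 2^-1 ^+ j)%R%:R :> R.
    by rewrite mulr_ge0 // ltW.
  have [zm|zm] := leP `|z| (2^-1 ^+ m).
    apply: le_trans (_ : _ <= 1 * N%:R ^+ k) _.
      rewrite mul1r -natrX ler_nat (leq_trans (max_card _)) //.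
      by rewrite card_ffun !card_ord.
    rewrite ler_wpM2r //.
    apply: le_trans (_ : _ <= 2 * (C + 1) * 1 + 0) _; first by lra.
    apply: lerD; last by rewrite mulr_ge0 // ltW.
    rewrite ler_wpM2l //; first by lra.
    rewrite (bigD1 ord_max) //= subnn expr0 zm mul1r.
    by rewrite lerDl sumr_ge0.
  have zp : 0 < `|z| by apply: lt_trans zm.
  apply: le_trans (CP _ _ _ mM _ zl) _; first by rewrite -normr_gt0.
  rewrite ler_wpM2r //.
  have [z1|z1] := leP `|z| 1; last first.
    apply: ler_wpDl.
      by rewrite mulr_ge0 ?sumr_ge0 // mulr_ge0 // addr_ge0.
    by rewrite ler_wpM2l // ler_pdivrMr // ler_peMr ?(ltW z1) // ltW.
  apply: ler_wpDr; first by rewrite mulr_ge0 // ltW.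
  have ex : exists j, 2^-1 ^+ j < `|z| by exists m.
  case: (ex_minnP ex) => -[|j] jz jmin.
    by move: jz; rewrite expr0 ltNge z1.
  have zj : `|z| <= 2^-1 ^+ j.
    by rewrite leNgt; apply/negP => /jmin; rewrite ltnn.
  have jm : (j < m.+1)%N by rewrite ltnW // ltnS; exact: jmin.
  rewrite (bigD1 (Ordinal jm)) //= zj mulr1 mulrDr.
  apply: ler_wpDr.
    by rewrite mulr_ge0 ?sumr_ge0 // mulr_ge0 // addr_ge0.
  apply: le_trans (_ : _ <= C * (2 * 2^-1 ^+ (m - j))) _.
    rewrite ler_wpM2l // ler_pdivrMr //.
    apply: le_trans (_ : _ <= 2 * 2^-1 ^+ (m - j) * 2^-1 ^+ j.+1) _.
      by rewrite -mulrA -exprD addnS subnK // exprS mulrA divff // mul1r.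
    by rewrite ler_wpM2l ?(ltW jz) // mulr_ge0 // ltW.
  by rewrite mulrCA -mulrA ler_wpM2l // mulrDl mul1r lerDl ltW.
(* Each of the [m.+1] scales contributes at most a constant times 2^-(m-j) v^j <= v^m. *)
have kern_mass (m : nat) (x : V) : (m <= M)%N ->
    \sum_(a <- L) a.2 * kern m (x - a.1) <= D1 * (m.+1%:R * v ^+ m).
  move=> mM.
  have -> : \sum_(a <- L) a.2 * kern m (x - a.1) =
      2 * (C + 1) * (\sum_(j < m.+1) 2^-1 ^+ (m - j) *
        \sum_(a <- L) a.2 * (`|x - a.1| <= 2^-1 ^+ j)%R%:R) +
      C * 2^-1 ^+ m * \sum_(a <- L) a.2.
    under eq_bigr do rewrite /kern mulrDr.
    rewrite big_split /=; congr (_ + _); last first.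
      by rewrite mulr_sumr; apply: eq_bigr => a _; rewrite mulrC.
    under eq_bigr do rewrite mulrCA.
    rewrite -mulr_sumr; congr (_ * _); under eq_bigr do rewrite mulr_sumr.
    rewrite exchange_big; apply: eq_bigr => j _.
    by rewrite mulr_sumr; apply: eq_bigr => a _; ring.
  have vm0 : 0 < v ^+ m by rewrite exprn_gt0.
  have halfv j : 2^-1 ^+ j <= v ^+ j :> R.
    by rewrite lerXn2r // ?nnegrE ?invr_ge0 // ltW.
  rewrite /D1 [leRHS]mulrDl; apply: lerD.
    rewrite -[leRHS]mulrA ler_wpM2l //; first by rewrite mulr_ge0 // addr_ge0.
    apply: le_trans (_ : _ <= \sum_(j < m.+1) 3 ^+ d * v ^+ m) _; last first.
      by rewrite sumr_const card_ord -[leLHS]mulr_natl mulrCA.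
    apply: ler_sum => j _.
    apply: le_trans (_ : _ <= v ^+ (m - j) * (3 ^+ d * v ^+ j)) _; last first.
      by rewrite mulrCA -exprD subnK // -ltnS ltn_ord.
    apply: ler_pM; [exact: ltW (half0 _)| |exact: halfv|].
      by rewrite big_seq sumr_ge0 // => a aL; rewrite mulr_ge0 // L0.
    apply: (ball_mass (w := fun j => v ^+ j)) => // b; apply: Lv.
    by apply: leq_trans mM; rewrite -ltnS.
  rewrite -!mulrA ler_wpM2l // mulrC; apply: ler_pM.
  - by rewrite big_seq sumr_ge0.
  - exact: ltW (half0 _).
  - exact: total.
  - apply: le_trans (halfv m) _; rewrite ler_peMl ?(ltW vm0) //.
    by rewrite ler1n.
rewrite exchange_big /=.
apply: le_trans (_ : _ <= \sum_(m < M.+1) u^-1 ^+ m *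
   (#|F|%:R * (D1 * (m.+1%:R * v ^+ m)) * N%:R ^+ k)) _; last first.
  have -> : \sum_(m < M.+1) u^-1 ^+ m *
     (#|F|%:R * (D1 * (m.+1%:R * v ^+ m)) * N%:R ^+ k) =
     #|F|%:R * D1 * (\sum_(m < M.+1) m.+1%:R * r ^+ m) * N%:R ^+ k.
    rewrite mulr_sumr mulr_suml; apply: eq_bigr => m _.
    by rewrite /r exprMn; ring.
  by rewrite ler_wpM2r // ler_wpM2l ?mulr_ge0 // sum_arith_geom_le.
apply: ler_sum => m _; rewrite -mulr_sumr.
rewrite ler_wpM2l ?exprn_ge0 ?invr_ge0 ?(ltW u0) //.
have mM : (m <= M)%N by rewrite -ltnS.
rewrite /correlation exchange_big /=.
apply: le_trans (_ : _ <= \sum_(a <- L) a.2 *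
   (D1 * (m.+1%:R * v ^+ m) * N%:R ^+ k)) _; last first.
  rewrite -mulr_suml -[leRHS]mulrA ler_wpM2r //.
  by rewrite !mulr_ge0 // exprn_ge0 // ltW.
rewrite big_seq [leRHS]big_seq; apply: ler_sum => a aL.
rewrite exchange_big /=.
apply: le_trans (_ : _ <= a.2 * ((\sum_(b <- L) b.2 * kern m (a.1 - b.1)) *
    N%:R ^+ k)) _; last first.
  by rewrite ler_wpM2l ?L0 // ler_wpM2r // kern_mass.
rewrite mulr_suml mulr_sumr big_seq [leRHS]big_seq; apply: ler_sum => b bL.
rewrite -mulr_sumr -!mulrA ler_wpM2l ?L0 // ler_wpM2l ?L0 //.
under eq_bigr do rewrite -pi_mapB.
apply: kernP => //; apply: le_trans (ler_normB _ _) _.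
by have [_ h1] := LP _ aL; have [_ h2] := LP _ bL; lra.
Qed.

End EnergyAverage.

(** * Exceptional parameters *)

Section Exceptional.
Context {R : realType} {n k : nat}.
Local Notation V := 'rV[R]_(k.+1 * n).

(* Up to constants, [thin u Y] says that Y has Hausdorff measure zero in the
   dimension s with u = 2^-s. *)
Definition thin {d : nat} (u : R) (Y : set 'rV[R]_d) := forall eps : R, 0 < eps ->
  exists (y : nat -> 'rV[R]_d) (m : nat -> nat),
    (forall z, Y z -> exists i, `|z - y i| < 2^-1 ^+ (m i).+1) /\
    forall N, \sum_(i < N) u ^+ m i <= eps.

Lemma compact_norm_le {d : nat} (l : R) : compact [set x : 'rV[R]_d | `|x| <= l].
Proof.
apply: bounded_closed_compact.
  exists l; split; first exact: num_real.
  by move=> M lM x /= xl; apply: le_trans xl (ltW lM).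
apply: (@closed_comp _ _ (fun x : 'rV[R]_d => `|x|) [set r | r <= l]).
  by move=> x _; exact: norm_continuous.
exact: closed_le.
Qed.

Lemma open_pi_cover (t : 'rV[R]_k) (y : nat -> 'rV[R]_n) (m : nat -> nat) N :
  open [set x : V | exists i, [/\ (i < N)%N, (m i <= N)%N &
    `|pi_map t x - y i| < 2^-1 ^+ (m i).+1]].
Proof.
pose La := 1 + k%:R * `|t|.
have La0 : 0 < La by rewrite /La ltr_pwDl // mulr_ge0.
rewrite openE => x [i [iN mN xi]]; apply/nbhs_ballP.
exists ((2^-1 ^+ (m i).+1 - `|pi_map t x - y i|) / La) => /=.
  by rewrite divr_gt0 // subr_gt0.
move=> z; rewrite -ball_normE /= => xz; exists i; split => //.
apply: le_lt_trans (ler_distD (pi_map t x) _ _) _.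
rewrite -ltrBrDr; move: xz; rewrite ltr_pdivlMr // => /(le_lt_trans _); apply.
rewrite distrC -pi_mapB mulrC; apply: pi_map_bound => // j; exact: coord_norm.
Qed.

(** Exceptional parameters have large energies at all fine scales, while the average bound leaves
    few grid cells with large energy. *)
Lemma exceptional_content (X : set V) (u v c0 e : R) (B : nat) :
  suslin X -> 2^-1 <= v -> v < u -> 0 < c0 ->
  ~ content_le lev (fun m => v ^+ m) X c0 -> (0 < B)%N -> 0 < e ->
  content_le lev (fun m => 2^-1 ^+ (k * m))
    [set t | `|t| < B%:R /\ thin u [set pi_map t x | x in X]] e.
Proof.
move=> [C [Ccl Cext Cdec XE]] v2 vu c0p nX B0 e0.
have v0 : 0 < v by apply: lt_le_trans v2; rewrite invr_gt0.
have u0 : 0 < u by exact: lt_trans vu.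
have vm0 m : 0 <= v ^+ m by rewrite exprn_ge0 ?(ltW v0).
(* Continuity along increasing sets reduces to a bounded part of [X]. *)
have [l nXl] : exists l : nat,
    ~ content_le lev (fun m => v ^+ m) (X `&` [set x | `|x| <= l%:R]) (c0 / 2).
  apply: contrapT => nex; apply: nX.
  have h (l : nat) : content_le lev (fun m => v ^+ m)
      (X `&` [set x | `|x| <= l%:R]) (c0 / 2).
    by apply: contrapT => ?; apply: nex; exists l.
  have c02 : 0 < c0 / 2 by rewrite divr_gt0.
  have := content_le_bigcup (@levS R _) _ h c02.
  rewrite -splitr => h'; apply: content_leW (h' _) => //.
    move=> x Xx; exists (Num.truncn `|x|).+1 => //; split => //=.
    exact/ltW/truncnS_gt.
  move=> l' x [Xx xl]; split => //=; rewrite (le_trans xl) // ler_nat //.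
pose A : set V := [set x | `|x| <= l%:R].
pose C' n f := C n f `&` A.
have [m mP] : exists m : nat -> nat, forall j, ~ content_le lev (fun m => v ^+ m)
    [set x | exists f, (forall i, (i < j)%N -> (f i <= m i)%N) /\ C' j f x] (c0 / 4).
  apply: (@content_capacitable _ _ _ lev _ (@levS R _) C' (c0 / 4) (c0 / 2)).
    by lra.
  apply: contra_not nXl; apply: content_leW => // x [+ Ax].
  by rewrite XE => -[f fC]; exists f => j; split.
pose D j : set V := [set x | exists f,
  (forall i, (i < j)%N -> (f i <= m i)%N) /\ C' j f x].
have D_A j x : D j x -> `|x| <= l%:R by move=> [f [_ []]].
have /choice [L LP] M : exists L : seq (V * R),
    [/\ forall a, a \in L -> 0 <= a.2, forall a, a \in L -> D M a.1,
     forall j b, (j <= M)%N -> \sum_(a <- L | lev j a.1 == b) a.2 <= v ^+ j &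
     c0 / 4 <= \sum_(a <- L) a.2].
  have [F [h hP]] := @lev_finite R (k.+1 * n) M l.
  have [S [SD Snet]] := exists_net h (D M).
  have [L [LS L0 Lv Lt]] := greedy_mass lev vm0 M S.
  exists L; split => //.
    by move=> a aL; apply: SD; rewrite -LS map_f.
  rewrite leNgt; apply/negP => /ltW Lc; apply: (mP M).
  apply: (content_leW (@subset_refl _ (D M)) Lc).
  apply: (content_le_mass (@levS R _) L0 Lt) => x Dx.
  have [y yS hxy] := Snet x Dx; exists y => //; apply: hP => //.
    exact: D_A Dx.
  by apply: (@D_A M); exact: SD.
(* Moving [t] to its grid point changes pi_t(a - b) by at most k 2^-M (2l), so radius 2^-j grows to
   at most [c1] 2^-j for j <= M. *)
pose c1 : R := 1 + k%:R * (2 * l%:R).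
have c10 : 0 <= c1 by rewrite addr_ge0 // !mulr_ge0.
have [K [K0 KP]] := @energy_average R n k B l u v c1 B0 c10 v2 vu.
(* By Markov's inequality the cells of energy at least [la] have total weight at most [K'] / [la] =
   [e / 2]. Then [eps] is chosen so that the energy lower bound equals [la]; the summand 1 keeps
   [K'] positive. *)
pose K' := (2 * B)%N%:R ^+ k * K + 1.
have K'0 : 0 < K' by rewrite /K' ltr_wpDl // mulr_ge0 // exprn_ge0.
pose eps := (c0 / 4) ^+ 2 * e / (2 * K').
have eps0 : 0 < eps by rewrite !(divr_gt0, mulr_gt0, exprn_gt0).
pose la := (c0 / 4) ^+ 2 / eps.
have laE : la = 2 * K' / e.
  by rewrite /la /eps; field; rewrite !gt_eqF.
have la0 : 0 < la by rewrite laE divr_gt0 // mulr_gt0.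
pose Bad M0 : set 'rV[R]_k := [set t | `|t| < B%:R /\
  forall M, (M0 <= M)%N -> la <= energy (pi_map t) u 1 M (L M)].
have Badc M : content_le lev (fun m => 2^-1 ^+ (k * m)) (Bad M) (e / 2).
  set N := (2 * B * 2 ^ M)%N.
  pose Q := [set f : {ffun 'I_k -> 'I_N} |
    la <= energy (pi_map (@grid R k B M f)) u c1 M (L M)]%SET.
  have [L0 LD Lv _] := LP M.
  have QK : la * #|Q|%:R <= K * N%:R ^+ k.
    apply: le_trans (KP M (L M) _ Lv); last first.
      by move=> a aL; split; [exact: L0|apply: (D_A M); exact: LD].
    rewrite -sum1_card natr_sum mulr_sumr big_mkcond /=; apply: ler_sum => f _.
    rewrite inE mulr1; case: ifP => // _; apply: sumr_ge0 => j _.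
    rewrite mulr_ge0 ?exprn_ge0 ?invr_ge0 ?(ltW u0) // /correlation.
    rewrite big_seq sumr_ge0 // => a aL; rewrite big_seq sumr_ge0 // => b bL.
    by rewrite !mulr_ge0 ?L0.
  exists [set q | exists2 f, f \in Q & q = (M, lev M (@grid R k B M f))]; split.
    move=> t [tB tE]; have [f tf] := lev_grid M tB; exists M; exists f; last first.
      by rewrite tf.
    rewrite inE (le_trans (tE M (leqnn _))) //; apply: ler_energy => //.
    move=> j a b jM aL bL; rewrite mul1r -!pi_mapB => ab.
    have r0 : 0 <= 2^-1 ^+ M :> R by rewrite exprn_ge0.
    have gt i : `|@grid R k B M f 0 i - t 0 i| <= 2^-1 ^+ M.
      by rewrite distrC; apply: lev_dist.
    apply: le_trans (pi_map_perturb _ r0 gt) _.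
    rewrite /c1 mulrDl mul1r lerD // -[leRHS]mulrA [leRHS]mulrA.
    rewrite mulrAC -!mulrA ler_wpM2l // mulrA ler_pM //.
      apply: le_trans (ler_normB _ _) _.
      by have := D_A _ _ (LD _ aL); have := D_A _ _ (LD _ bL); lra.
    by rewrite ler_wiXn2l // ?invr_ge0 // invf_le1 // ler1n.
  move=> s us sQ.
  have sz : (size s <= #|Q|)%N.
    rewrite cardE -(size_map (fun f => (M, lev M (@grid R k B M f)))).
    apply: uniq_leq_size => // q /sQ [f fQ ->].
    by apply: (map_f (fun f => (M, lev M (@grid R k B M f)))); rewrite mem_enum.
  have -> : \sum_(q <- s) 2^-1 ^+ (k * q.1) = (size s)%:R * 2^-1 ^+ (k * M) :> R.
    rewrite big_seq (eq_bigr (fun=> 2^-1 ^+ (k * M))).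
      by rewrite -big_seq big_const_seq iter_addr_0 count_predT mulr_natl.
    by move=> q /sQ [f _ ->].
  have p0 : 0 < 2^-1 ^+ (k * M) :> R by rewrite exprn_gt0.
  apply: le_trans (_ : _ <= #|Q|%:R * 2^-1 ^+ (k * M)) _.
    by rewrite ler_wpM2r ?(ltW p0) // ler_nat.
  rewrite -(ler_pM2l la0) mulrA.
  apply: le_trans (_ : _ <= K * N%:R ^+ k * 2^-1 ^+ (k * M)) _.
    by rewrite ler_wpM2r ?(ltW p0).
  have -> : K * N%:R ^+ k * 2^-1 ^+ (k * M) = K * (2 * B)%N%:R ^+ k.
    rewrite /N natrM exprMn natrX -exprM [(M * k)%N]mulnC exprVn.
    by rewrite -!mulrA divff ?mulr1 // expf_neq0.
  have -> : la * (e / 2) = K' by rewrite laE; field; rewrite gt_eqF.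
  by rewrite /K' mulrC lerDl.
have e2 : 0 < e / 2 by rewrite divr_gt0.
have := content_le_bigcup (@levS R _) _ Badc e2; rewrite -splitr => h.
apply: content_leW (h _) => //; last first.
  move=> M t [tB tE]; split => // M' /ltnW; exact: tE.
move=> t [tB /(_ _ eps0) [y [mm [ycov ysum]]]].
pose O N : set V := [set x | exists i, [/\ (i < N)%N, (mm i <= N)%N &
    `|pi_map t x - y i| < 2^-1 ^+ (mm i).+1]].
have Oinc N : O N `<=` O N.+1.
  by move=> x [i [iN mN xi]]; exists i; split; rewrite 1?ltnW.
have C'dec i f : C' i.+1 f `<=` C' i f by move=> x [/Cdec ? ?]; split.
(* Compactness gives a depth for each branch [f]; the fan argument makes it uniform, so that
   finitely many balls cover the image of [D M0]. *)
have [M0 M0P] : exists M0, forall f, (forall i, (i < M0)%N -> (f i <= m i)%N) ->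
    C' M0 f `<=` O M0.
  apply: (@fan_uniform m (fun N f => C' N f `<=` O N)).
  - by move=> N f g fg; rewrite /C' (Cext _ _ _ fg).
  - by move=> N f CO x /C'dec /CO /Oinc.
  move=> f _; apply: (@compact_decreasing _ A (C' ^~ f) O).
  - exact: compact_norm_le.
  - by move=> N x [].
  - move=> N; apply: closedI => //.
    by apply: compact_closed; [exact: norm_hausdorff|exact: compact_norm_le].
  - by [].
  - by move=> N; exact: open_pi_cover.
  - by [].
  move=> x Cx; have Xx : X x by rewrite XE; exists f => N; case: (Cx N I).
  have [i xi] := ycov _ (ex_intro2 _ _ x Xx erefl).
  exists (maxn i.+1 (mm i)) => //; exists i; split => //.
    exact: leq_maxl.
  exact: leq_maxr.
have DO M : (M0 <= M)%N -> D M `<=` O M.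
  move=> /subnK <-; elim: (M - M0)%N => [|j IH] x.
    by move=> [f [fm fC]]; exact: (M0P f fm).
  move=> [f [fm fC]]; apply: Oinc; apply: IH; exists f; split.
    by move=> i /ltnW; rewrite -ltnS; apply: fm.
  exact: C'dec.
exists M0 => //; split => // M MM.
have [L0 LD _ Lc] := LP M.
apply: (@energy_lower_bound _ _ _ (pi_map t) u (c0 / 4) eps M M (L M) y mm) => //.
  by rewrite divr_gt0.
by move=> a aL; exact: DO (LD _ aL).
Qed.

End Exceptional.

(** * Hausdorff dimension *)

Section HausdorffFacts.
Context {R : realType}.

Lemma norm_le_euclidean {d : nat} (x : 'rV[R]_d) : `|x| <= euclidean_norm x.
Proof.
apply: norm_le_coord; first exact: sqrtr_ge0.
move=> j; rewrite -sqrtr_sqr ler_sqrt; last by rewrite sumr_ge0 // => i _; exact: sqr_ge0.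
by rewrite (bigD1 j) //= lerDl sumr_ge0 // => i _; exact: sqr_ge0.
Qed.

Lemma euclidean_le_norm {d : nat} (x : 'rV[R]_d) :
  euclidean_norm x <= Num.sqrt d%:R * `|x|.
Proof.
rewrite -[X in _ * X]ger0_norm // -sqrtr_sqr -sqrtrM // ler_sqrt; last first.
  by rewrite mulr_ge0 // sqr_ge0.
apply: le_trans (_ : _ <= \sum_(i < d) `|x| ^+ 2) _; last first.
  by rewrite sumr_const card_ord mulr_natl.
by apply: ler_sum => i _; rewrite -real_normK ?num_real // lerXn2r ?nnegrE ?coord_norm.
Qed.

Lemma diam_ge0 {d : nat} (E : set 'rV[R]_d) : (0 <= diam E)%E.
Proof. by rewrite le_max lexx. Qed.

Lemma diam_ub {d : nat} (E : set 'rV[R]_d) x y : E x -> E y ->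
  ((euclidean_norm (x - y))%:E <= diam E)%E.
Proof.
move=> Ex Ey; rewrite le_max; apply/orP; right.
by apply: ereal_sup_ubound; exists x, y.
Qed.

Lemma diam_le {d : nat} (E : set 'rV[R]_d) (r : R) : 0 <= r ->
  (forall x y, E x -> E y -> euclidean_norm (x - y) <= r) -> (diam E <= r%:E)%E.
Proof.
move=> r0 h; rewrite ge_max lee_fin r0 /=; apply: ub_ereal_sup.
by move=> _ [x [y [Ex Ey ->]]]; rewrite lee_fin h.
Qed.

Lemma diam_real {d : nat} (E : set 'rV[R]_d) (r : R) : (diam E <= r%:E)%E ->
  exists2 a : R, diam E = a%:E & 0 <= a <= r.
Proof.
have := diam_ge0 E; case: (diam E) => [a||] //=; rewrite !lee_fin => a0 ar.
by exists a => //; rewrite a0.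
Qed.

Lemma diam_pow_ge0 {d : nat} (s : R) (E : set 'rV[R]_d) : (0 <= diam_pow s E)%E.
Proof. by rewrite /diam_pow; case: ifP => // _; exact: poweR_ge0. Qed.

Lemma hausdorff_content_ge0 {d : nat} (s r : R) (E : set 'rV[R]_d) :
  (0 <= hausdorff_content s r E)%E.
Proof.
apply: le_ereal_inf_tmp => _ [F [_ _ ->]].
by apply: nneseries_ge0 => i _ _; exact: diam_pow_ge0.
Qed.

Lemma hausdorff_measure_eq0 {d : nat} (s : R) (E : set 'rV[R]_d) :
  hausdorff_measure s E = 0%E <->
  forall r e : R, 0 < r -> 0 < e -> exists F : nat -> set 'rV[R]_d,
    [/\ E `<=` \bigcup_i F i, forall i, (diam (F i) <= r%:E)%E &
        (\sum_(0 <= i <oo) diam_pow s (F i) <= e%:E)%E].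
Proof.
split=> [E0 r e r0 e0|h].
  have : (hausdorff_content s r E < e%:E)%E.
    apply: le_lt_trans (_ : _ <= 0)%E _; last by rewrite lte_fin.
    by rewrite -E0; apply: ereal_sup_ubound; exists r.
  by move=> /ereal_inf_lt [_ [F [? ? ->]] /ltW ?]; exists F.
have c0 r : 0 < r -> hausdorff_content s r E = 0%E.
  move=> r0; apply/eqP; rewrite eq_le hausdorff_content_ge0 andbT.
  apply/lee_addgt0Pr => e e0; rewrite add0e; apply: ge_ereal_inf.
  by have [F [EF Fr Fe]] := h r e r0 e0; eexists; [exists F; split|exact: Fe].
apply/eqP; rewrite eq_le; apply/andP; split.
  by apply: ub_ereal_sup => _ [r /= r0 <-]; rewrite c0.
apply: le_trans (hausdorff_content_ge0 s 1 E) _.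
by apply: ereal_sup_ubound; exists 1 => //=; exact: ltr01.
Qed.

Lemma hausdorff_dim_ge0 {d : nat} (E : set 'rV[R]_d) : (0 <= hausdorff_dim E)%E.
Proof. by apply: le_ereal_inf_tmp => _ [s [s0 _] <-]; rewrite lee_fin. Qed.

Lemma hausdorff_dim_lipschitz {d d' : nat} (f : 'rV[R]_d -> 'rV[R]_d') (C : R)
  (E : set 'rV[R]_d) : (forall x y, `|f x - f y| <= C * `|x - y|) ->
  (hausdorff_dim [set f x | x in E] <= hausdorff_dim E)%E.
Proof.
move=> fC; apply: ereal_inf_le_tmp => _ [s [s0 Es] <-]; exists s => //; split => //.
(* The square root converts the sup norm to the Euclidean norm; the summand 1 makes [La]
   positive. *)
pose La := Num.sqrt d'%:R * `|C| + 1.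
have La0 : 0 < La by rewrite ltr_wpDl // mulr_ge0 ?sqrtr_ge0.
have fLa x y : euclidean_norm (f x - f y) <= La * euclidean_norm (x - y).
  apply: le_trans (euclidean_le_norm _) _.
  apply: le_trans (_ : _ <= Num.sqrt d'%:R * (`|C| * `|x - y|)) _.
    rewrite ler_wpM2l ?sqrtr_ge0 // (le_trans (fC _ _)) // ler_wpM2r //.
    exact: ler_norm.
  rewrite mulrA ler_pM ?mulr_ge0 ?sqrtr_ge0 ?norm_le_euclidean //.
  by rewrite lerDl.
have Ls0 : 0 < La `^ s by rewrite powR_gt0.
apply/hausdorff_measure_eq0 => r e r0 e0.
have [F [EF Fr Fe]] := (hausdorff_measure_eq0 s E).1 Es (r / La) (e / La `^ s)
  (divr_gt0 r0 La0) (divr_gt0 e0 Ls0).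
have dF i : exists2 a : R, diam (F i) = a%:E &
    0 <= a <= r / La /\ (diam [set f x | x in F i] <= (La * a)%:E)%E.
  have [a Fa aP] := diam_real (Fr i); exists a => //; split => //.
  apply: diam_le; first by case/andP: aP => a0 _; rewrite mulr_ge0 // ltW.
  move=> _ _ [x Fx <-] [y Fy <-]; apply: le_trans (fLa _ _) _.
  by rewrite ler_wpM2l ?(ltW La0) // -lee_fin -Fa diam_ub.
exists (fun i => [set f x | x in F i]); split.
- by move=> _ [x /EF [i _ Fx] <-]; exists i => //; exists x.
- move=> i; have [a _ [/andP[_ ar] /le_trans]] := dF i; apply.
  by rewrite lee_fin mulrC -ler_pdivlMr.
have -> : e = La `^ s * (e / La `^ s) by rewrite mulrCA divff ?mulr1 // gt_eqF.
rewrite EFinM; apply: le_trans (_ : _ <= (La `^ s)%:E *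
    \sum_(0 <= i <oo) diam_pow s (F i))%E _; last first.
  by rewrite lee_pmul2l.
rewrite -nneseriesZl; last by move=> i _; exact: diam_pow_ge0.
apply: lee_nneseries => i _; first by move=> _; exact: diam_pow_ge0.
rewrite /diam_pow; case: ifP => [_|/negbT F0].
  by rewrite mule_ge0 ?lee_fin ?(ltW Ls0) //; exact: diam_pow_ge0.
rewrite ifF; last first.
  apply/negbTE; apply: contra F0 => /eqP Fi0; apply/eqP.
  by rewrite Fi0 image_set0.
have [a -> [/andP[a0 _] fFa]] := dF i.
rewrite poweR_EFin -EFinM -powRM ?(ltW La0) // -poweR_EFin.
apply: gt0_ler_poweR => //; rewrite in_itv /= ?diam_ge0 ?leey //.
by rewrite lee_fin mulr_ge0 // ltW.
Qed.

Lemma half_powR (s : R) m : (2^-1 ^+ m) `^ s = (2 `^ (- s)) ^+ m.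
Proof.
have -> : 2^-1 = 2 `^ (- 1) :> R by rewrite powR_inv1.
rewrite -(powR_mulrn m (powR_ge0 2 (- 1))) -(powR_mulrn m (powR_ge0 2 (- s))).
by rewrite -!powRrM mulN1r !mulNr [s * _]mulrC.
Qed.

Lemma exprn_small (u e : R) : 0 <= u -> u < 1 -> 0 < e -> exists m, u ^+ m <= e.
Proof.
move=> u0 u1 e0; have := @cvg_expr _ u; rewrite ger0_norm // => /(_ u1).
move=> /cvgrPdist_le /(_ e e0) [m _ /(_ m (leqnn m))] /=.
by rewrite sub0r normrN ger0_norm ?exprn_ge0 // => ?; exists m.
Qed.

Lemma ltr_powR2 (a b : R) : a < b -> 2 `^ a < 2 `^ b.
Proof. by move=> ab; rewrite /powR gt_eqF // ltr_expR ltr_pM2r ?ln_gt0 // ltr1n. Qed.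

End HausdorffFacts.

(** * Dyadic contents against Hausdorff and Lebesgue measure *)

Section Conversions.
Context {R : realType}.

(** Turns a family of cells into a sequence, with [None] at idle indices, and its weight bound into
    a bound for series dominated by the weights. *)
Lemma weight_le_enum {K : countType} (w : nat -> R) (U : set (nat * K)) (c : R) :
  weight_le w U c -> exists q : nat -> option (nat * K),
  [/\ forall p, U p -> exists i, q i = Some p,
      forall i p, q i = Some p -> U p &
      forall (C : R) (g : nat -> \bar R), 0 <= C -> (forall i, (0 <= g i)%E) ->
        (forall i p, q i = Some p -> (g i <= (C * w p.1)%:E)%E) ->
        (forall i, q i = None -> g i = 0%E) ->
        (\sum_(0 <= i <oo) g i <= (C * c)%:E)%E].
Proof.
move=> Uc.
exists (fun i => if pickle_inv i is Some p then
  if `[< U p >] then Some p else None else None); split.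
- by move=> p Up; exists (pickle p); rewrite pickleK_inv asboolT.
- move=> i p; case: pickle_inv => // p'; case: ifP => // /asboolP Up' [<-] //.
move=> C g C0 g0 gU gN.
apply: lime_le; first by apply: is_cvg_nneseries => i _ _; exact: g0.
apply: nearW => N.
pose s := [seq q <- pmap (@pickle_inv (nat * K)%type) (index_iota 0 N) | `[< U q >]].
have us : uniq s.
  by rewrite filter_uniq // (pmap_uniq pickle_invK) // iota_uniq.
apply: le_trans (_ : _ <= (C * \sum_(q <- s) w q.1)%:E)%E _; last first.
  rewrite lee_fin ler_wpM2l //; apply: Uc => // q.
  by rewrite mem_filter => /andP[/asboolP].
have -> : C * \sum_(q <- s) w q.1 = \sum_(0 <= i < N)
    oapp (fun q => if `[< U q >] then C * w q.1 else 0) 0 (pickle_inv i).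
  by rewrite mulr_sumr big_filter big_mkcond big_pmap.
rewrite -sumEFin; apply: lee_sum => i _.
have := gU i; have := gN i; case: (pickle_inv i) => [p|] /=; last first.
  by move=> -> //.
case: ifP => [_ _ /(_ p erefl) //|_]; by move=> -> //.
Qed.

Lemma lebesgue_outer_eq0 (k : nat) (A : set 'rV[R]_k) : (0 < k)%N ->
  (forall e : R, 0 < e -> content_le lev (fun m => 2^-1 ^+ (k * m)) A e) ->
  lebesgue_outer A = 0%E.
Proof.
move=> k0 h; apply/eqP; rewrite eq_le; apply/andP; split; last first.
  apply: le_ereal_inf_tmp => _ [a [b [ab _ ->]]]; apply: nneseries_ge0 => i _ _.
  by rewrite lee_fin prodr_ge0 // => j _; rewrite subr_ge0.
apply/lee_addgt0Pr => e e0; rewrite add0e; have [U [UA Ue]] := h e e0.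
have [q [qU _ qs]] := weight_le_enum Ue.
(* Idle indices receive the degenerate box {0}, of volume 0 since [k] is positive. *)
pose a (i : nat) : 'rV[R]_k :=
  if q i is Some p then \row_j ((p.2 0 j)%:~R * 2^-1 ^+ p.1) else 0.
pose b (i : nat) : 'rV[R]_k :=
  if q i is Some p then \row_j (((p.2 0 j)%:~R + 1) * 2^-1 ^+ p.1) else 0.
have ab i j : a i 0 j <= b i 0 j.
  rewrite /a /b; case: (q i) => [p|]; last by rewrite mxE.
  by rewrite !mxE ler_wpM2r ?exprn_ge0 ?invr_ge0 // lerDl.
apply: (@le_trans _ _ (\sum_(0 <= i <oo) (\prod_(j < k) (b i 0 j - a i 0 j))%:E)%E).
  apply: ereal_inf_lbound; exists a, b; split => // x /UA [m Um].
  have [i qi] := qU _ Um; exists i => // j; rewrite /a /b qi !mxE /=.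
  have m0 : 0 < 2 ^+ m :> R by rewrite exprn_gt0.
  have := floor_itv (2 ^+ m * x 0 j); rewrite intrD => /andP[h1 h2].
  by rewrite exprVn ler_pdivrMr // ler_pdivlMr // [x 0 j * _]mulrC h1 ltW.
rewrite -[e]mul1r; apply: qs => //.
- by move=> i; rewrite lee_fin prodr_ge0 // => j _; rewrite subr_ge0.
- move=> i p qi; rewrite mul1r lee_fin /a /b qi.
  under eq_bigr do rewrite !mxE -mulrBl [_ + 1]addrC addrK mul1r.
  by rewrite prodr_const card_ord mulnC exprM.
move=> i qi; congr (_%:E).
by rewrite (bigD1 (Ordinal k0)) //= /a /b qi subrr mul0r.
Qed.

Lemma hausdorff_measure_eq0_content {d : nat} (s : R) (X : set 'rV[R]_d) :
  0 < s -> (forall c : R, 0 < c -> content_le lev (fun m => (2 `^ (- s)) ^+ m) X c) ->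
  hausdorff_measure s X = 0%E.
Proof.
move=> s0 h; apply/hausdorff_measure_eq0 => r e r0 e0.
set v := 2 `^ (- s) in h.
have v0 : 0 < v by rewrite powR_gt0.
have v1 : v < 1 by rewrite -(powRr0 2) ltr_powR2 // oppr_lt0.
pose D : R := Num.sqrt d%:R.
have D0 : 0 <= D by exact: sqrtr_ge0.
have [m0 m0P] : exists m0, 2^-1 ^+ m0 <= r / (D + 1).
  apply: exprn_small; rewrite ?invr_ge0 ?invf_lt1 ?ltr1n //.
  by rewrite divr_gt0 // ltr_wpDl.
pose C := D `^ s + 1.
have C0 : 0 < C by rewrite ltr_wpDl // powR_ge0.
(* The first bound excludes cells of level at most [m0], hence forces diameters at most [r]; the
   second makes the sum at most [e]. *)
pose c := Num.min (v ^+ m0 / 2) (e / C).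
have c0 : 0 < c by rewrite lt_min !divr_gt0 ?exprn_gt0.
have [U [UX Uc]] := h c c0.
have deep q : U q -> (m0 < q.1)%N.
  move=> Uq; rewrite ltnNge; apply/negP => qm.
  have := Uc [:: q] isT; rewrite big_seq1 => /(_ _)/= h1.
  have : v ^+ q.1 <= c by apply: h1 => p; rewrite inE => /eqP ->.
  rewrite le_min => /andP[h2 _].
  have : v ^+ m0 <= v ^+ q.1 by rewrite ler_wiXn2l // ltW.
  have : 0 < v ^+ m0 by rewrite exprn_gt0.
  lra.
have [q [qU Uq qs]] := weight_le_enum Uc.
pose F (i : nat) : set 'rV[R]_d :=
  if q i is Some p then [set x | lev p.1 x = p.2] else set0.
have dF i p : q i = Some p -> (diam (F i) <= (D * 2^-1 ^+ p.1)%:E)%E.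
  move=> qi; have p0 : 0 <= 2^-1 ^+ p.1 :> R by rewrite exprn_ge0.
  apply: diam_le; first by rewrite mulr_ge0.
  rewrite /F qi => x y /= xp yp.
  apply: le_trans (euclidean_le_norm _) _; rewrite ler_wpM2l //.
  apply: norm_le_coord => // j; rewrite !mxE; apply: lev_dist.
  by rewrite xp yp.
have F0 i : q i = None -> F i = set0 by rewrite /F => ->.
exists F; split.
- by move=> x /UX [m /qU [i qi]]; exists i => //; rewrite /F qi.
- move=> i; case qi : (q i) => [p|].
    apply: le_trans (dF i p qi) _; rewrite lee_fin.
    apply: le_trans (_ : _ <= (D + 1) * 2^-1 ^+ m0) _.
      apply: ler_pM; rewrite ?exprn_ge0 ?invr_ge0 ?lerDl //.
      rewrite ler_wiXn2l ?invr_ge0 ?invf_le1 ?ler1n // ltnW // deep //.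
      exact: Uq qi.
    by rewrite mulrC -ler_pdivlMr // ltr_wpDl.
  by rewrite F0 //; apply: diam_le => //; exact: ltW.
apply: le_trans (_ : _ <= (C * c)%:E)%E _; last first.
  by rewrite lee_fin mulrC -ler_pdivlMr // ge_min lexx orbT.
apply: qs.
- exact: ltW.
- by move=> i; exact: diam_pow_ge0.
- move=> i p qi; rewrite /diam_pow; case: ifP => _.
    by rewrite lee_fin mulr_ge0 ?exprn_ge0 // ltW.
  have p0 : 0 <= 2^-1 ^+ p.1 :> R by rewrite exprn_ge0.
  apply: le_trans (_ : _ <= ((D * 2^-1 ^+ p.1)%:E `^ s))%E _.
    apply: gt0_ler_poweR; rewrite ?(ltW s0) ?(dF _ _ qi) //.
      by rewrite in_itv /= diam_ge0 leey.
    by rewrite in_itv /= leey lee_fin mulr_ge0.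
  rewrite poweR_EFin lee_fin powRM // half_powR -/v ler_wpM2r ?lerDl //.
  by rewrite exprn_ge0 // ltW.
- by move=> i /F0 Fi; rewrite /diam_pow Fi eqxx.
Qed.

(** The ball radius is comparable to the diameter; [eta] pays for sets that are empty or of diameter
    0. *)
Lemma small_set_ball {d : nat} (E : set 'rV[R]_d) (sg s eta : R) :
  0 <= sg -> sg < s -> 0 < eta -> (diam E <= (8^-1)%:E)%E ->
  exists (y : 'rV[R]_d) (m : nat), (forall z, E z -> `|z - y| < 2^-1 ^+ m.+1) /\
    (((2 `^ (- s)) ^+ m)%:E <= (8 `^ s)%:E * diam_pow sg E + eta%:E)%E.
Proof.
move=> sg0 sgs eta0 dE; have s0 : 0 < s by exact: le_lt_trans sgs.
have h0 m : 0 < 2^-1 ^+ m :> R by rewrite exprn_gt0.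
have [m1 m1P] : exists m, (2 `^ (- s)) ^+ m <= eta.
  apply: exprn_small => //.
  by rewrite -[ltRHS](powRr0 2) ltr_powR2 // oppr_lt0.
have m1E : (((2 `^ (- s)) ^+ m1)%:E <= (8 `^ s)%:E * diam_pow sg E + eta%:E)%E.
  rewrite -[leLHS]add0e leeD ?lee_fin // mule_ge0 ?lee_fin ?powR_ge0 //.
  exact: diam_pow_ge0.
have [E0|/set0P [y Ey]] := eqVneq E set0.
  by exists 0, m1; split => // z; rewrite E0.
have [r rE /andP[r0 r8]] := diam_real dE.
have yr z : E z -> `|z - y| <= r.
  move=> Ez; apply: le_trans (norm_le_euclidean _) _.
  by rewrite -lee_fin -rE diam_ub.
have [r00|rp] := eqVneq r 0.
  by exists y, m1; split => // z /yr; rewrite r00 => /le_lt_trans; apply.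
have {r0 rp} r0 : 0 < r by rewrite lt_neqAle eq_sym rp.
have ex : exists j, 2^-1 ^+ j <= 4 * r :> R.
  by apply: exprn_small; rewrite ?invr_ge0 ?invf_lt1 ?ltr1n // mulr_gt0.
(* Minimality gives 4r < 2^-m <= 8r; level 0 is impossible because r <= 1/8. *)
case: (ex_minnP ex) => -[|m] mr mmin; first by move: mr; rewrite expr0; lra.
have mr' : 4 * r < 2^-1 ^+ m.
  by rewrite ltNge; apply/negP => /mmin; rewrite ltnn.
exists y, m; split => [z /yr /le_lt_trans|].
  by apply; rewrite exprS; lra.
rewrite -[leLHS]adde0 leeD ?lee_fin ?(ltW eta0) //.
rewrite /diam_pow ifF; last by apply/negbTE/set0P; exists y.
rewrite rE poweR_EFin -EFinM lee_fin -half_powR.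
apply: le_trans (_ : _ <= (8 * r) `^ s) _.
  apply: ge0_ler_powR; rewrite ?nnegrE ?(ltW s0) ?(ltW (h0 _)) ?mulr_ge0 ?(ltW r0) //.
  by move: mr; rewrite exprS; lra.
rewrite powRM ?(ltW r0) // ler_wpM2l ?powR_ge0 //.
apply: ger_powR; last exact: ltW.
by rewrite r0 /=; lra.
Qed.

Lemma thin_hausdorff_dim {d : nat} (s : R) (Y : set 'rV[R]_d) :
  (hausdorff_dim Y < s%:E)%E -> thin (2 `^ (- s)) Y.
Proof.
move=> /ereal_inf_lt [_ [sg [sg0 Ysg] <-]]; rewrite lte_fin => sgs e e0.
have p0 : 0 < 8 `^ s :> R by rewrite powR_gt0.
have c0 : 0 < (8 : R)^-1 by rewrite invr_gt0.
have e2 : 0 < e / 2 / 8 `^ s by rewrite !divr_gt0.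
have [F [YF Fr Fe]] := (hausdorff_measure_eq0 sg Y).1 Ysg _ _ c0 e2.
(* These errors sum to at most [e / 2]; the other half goes to the diameters. *)
have eta0 (i : nat) : 0 < e / 2 * 2^-1 ^+ i.+1 :> R by rewrite mulr_gt0 ?divr_gt0 ?exprn_gt0.
have /choice [ym ymP] i : exists ym : 'rV[R]_d * nat,
    (forall z, F i z -> `|z - ym.1| < 2^-1 ^+ ym.2.+1) /\
    (((2 `^ (- s)) ^+ ym.2)%:E <=
      (8 `^ s)%:E * diam_pow sg (F i) + (e / 2 * 2^-1 ^+ i.+1)%:E)%E.
  by have [y [m ?]] := small_set_ball sg0 sgs (eta0 i) (Fr i); exists (y, m).
exists (fun i => (ym i).1), (fun i => (ym i).2); split.
  by move=> z /YF [i _ Fz]; exists i; exact: (ymP i).1.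
move=> N; rewrite -lee_fin -sumEFin.
apply: (@le_trans _ _ (\sum_(i < N) ((8 `^ s)%:E * diam_pow sg (F i) +
    (e / 2 * 2^-1 ^+ i.+1)%:E))%E).
  by apply: lee_sum => i _; exact: (ymP i).2.
rewrite big_split /= -ge0_sume_distrr; last first.
  by move=> i _; exact: diam_pow_ge0.
rewrite [X in (_ <= X%:E)%E]splitr EFinD; apply: leeD.
  have -> : e / 2 = 8 `^ s * (e / 2 / 8 `^ s).
    by rewrite mulrCA divff ?mulr1 // gt_eqF.
  rewrite EFinM lee_pmul2l //.
  apply: le_trans Fe; rewrite -(big_mkord xpredT (fun i => diam_pow sg (F i))).
  by apply: nneseries_lim_ge => i _ _; exact: diam_pow_ge0.
rewrite sumEFin lee_fin -mulr_sumr ler_piMr ?divr_ge0 ?(ltW e0) //.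
have -> : \sum_(i < N) 2^-1 ^+ i.+1 = 1 - 2^-1 ^+ N :> R.
  elim: N => [|N IH]; first by rewrite big_ord0 expr0 subrr.
  by rewrite big_ord_recr /= IH exprS; field.
by rewrite gerBl exprn_ge0.
Qed.

End Conversions.

(** Here v = 2^-s and u = 2^-s'; [2^-1 <= v] is where dimension at most 1 enters, and [s < a] makes
    the content of [X] positive. *)
Lemma content_le_low_dim {R : realType} (n k : nat) (X : set 'rV[R]_(k.+1 * n))
  (a s s' e : R) (B : nat) :
  borel_set X -> hausdorff_dim X = a%:E -> s' < s -> s < a -> a <= 1 ->
  (0 < B)%N -> 0 < e ->
  content_le lev (fun m => 2^-1 ^+ (k * m))
    [set t : 'rV[R]_k | `|t| < B%:R /\
       (hausdorff_dim [set pi_map t x | x in X] < s'%:E)%E] e.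
Proof.
move=> BX Xa s's sa a1 B0 e0.
have [s'0|s'0] := leP s' 0.
  exists set0; split => [t [_ /= ts]|q _ qs].
    have := le_lt_trans (hausdorff_dim_ge0 [set pi_map t x | x in X]) ts.
    by rewrite lte_fin ltNge s'0.
  rewrite big_seq big1 ?ltW // => p /qs [].
have s0 := lt_trans s'0 s's.
have [c c0 nXc] : exists2 c : R, 0 < c &
    ~ content_le lev (fun m => (2 `^ (- s)) ^+ m) X c.
  apply: contrapT => nex.
  have Xs : hausdorff_measure s X = 0%E.
    apply: hausdorff_measure_eq0_content => // c c0.
    by apply: contrapT => nc; apply: nex; exists c.
  have : (hausdorff_dim X <= s%:E)%E.
    by apply: ereal_inf_lbound; exists s => //; split => //; exact: ltW.
  by rewrite Xa lee_fin leNgt sa.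
have v2 : 2^-1 <= 2 `^ (- s) :> R.
  have -> : 2^-1 = 2 `^ (- 1) :> R by rewrite powR_inv1.
  by apply/ltW; rewrite ltr_powR2 // ltrN2; exact: lt_le_trans sa a1.
have vu : 2 `^ (- s) < 2 `^ (- s') :> R by rewrite ltr_powR2 // ltrN2.
apply: content_leW (exceptional_content (suslin_borel BX) v2 vu c0 nXc B0 e0) => //.
by move=> t [tB ts]; split => //; exact: thin_hausdorff_dim.
Qed.

Theorem corollary3p15 (R : realType) (n k : nat) (hn : (1 <= n)%N)
    (hk : (1 <= k)%N) (X : set 'rV[R]_(k.+1 * n)) (X0 : X !=set0)
    (BX : borel_set X) (dX : (hausdorff_dim X <= 1)%E) :
  lebesgue_ae (fun t : 'rV[R]_k =>
    hausdorff_dim [set pi_map t x | x in X] = hausdorff_dim X).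
Proof.
have le_dim (t : 'rV[R]_k) :
    (hausdorff_dim [set pi_map t x | x in X] <= hausdorff_dim X)%E.
  apply: (@hausdorff_dim_lipschitz _ _ _ _ (1 + k%:R * `|t|)) => x y.
  by rewrite -pi_mapB; apply: pi_map_bound => // i; exact: coord_norm.
have [a Xa a1] : exists2 a : R, hausdorff_dim X = a%:E & a <= 1.
  have := hausdorff_dim_ge0 X; case: (hausdorff_dim X) dX => [a||] //.
  by rewrite lee_fin => a1 _; exists a.
apply: (lebesgue_outer_eq0 hk) => e e0.
(* The gap 2/(i+1) leaves room for the intermediate exponent a - 1/(i+1); these sets increase to the
   exceptional set. *)
pose Bad (i : nat) := [set t : 'rV[R]_k | `|t| < i.+1%:R /\
  (hausdorff_dim [set pi_map t x | x in X] < (a - 2 / i.+1%:R)%:E)%E].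
have e2 : 0 < e / 2 by rewrite divr_gt0.
have Badc i : content_le lev (fun m => 2^-1 ^+ (k * m)) (Bad i) (e / 2).
  have i0 : 0 < (i.+1%:R : R)^-1 by rewrite invr_gt0.
  rewrite /Bad; set x := (i.+1%:R)^-1 in i0 *.
  by apply: (@content_le_low_dim _ _ _ _ a (a - x)) => //; lra.
have := content_le_bigcup (@levS R _) _ Badc e2; rewrite -splitr => h.
apply: content_leW (h _) => //; last first.
  move=> i t [ti ts]; split; first by rewrite (lt_le_trans ti) // ler_nat.
  apply: lt_le_trans ts _; rewrite lee_fin lerD2l lerN2 ler_pM2l //.
  by rewrite lef_pV2 ?posrE ?ltr0n // ler_nat.
move=> t /= tX.
have : (hausdorff_dim [set pi_map t x | x in X] < a%:E)%E.
  by rewrite -Xa lt_neqAle le_dim andbT; apply/eqP.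
have := hausdorff_dim_ge0 [set pi_map t x | x in X].
case E : (hausdorff_dim _) => [b||] //; rewrite lee_fin lte_fin => b0 ba.
have ab : 0 < a - b by rewrite subr_gt0.
exists (maxn (Num.truncn `|t|) (Num.truncn (2 / (a - b)))) => //; split.
  apply: lt_le_trans (truncnS_gt _) _; rewrite ler_nat ltnS; exact: leq_maxl.
rewrite E lte_fin ltrBrDl -ltrBrDr ltr_pdivrMr // mulrC -ltr_pdivrMr //.
by apply: lt_le_trans (truncnS_gt _) _; rewrite ler_nat ltnS; exact: leq_maxr.
Qed.
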